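(* For an odd integer $R\geq 3$, let $\alpha=\alpha(R)\in(0,1)$ be given by the purely periodic negative continued fraction expansion $$\alpha=[0;\overline{R,R,R+1,R,R+1,R+1,R,R+1,R+1,R,R+1}]^-.$$ Then, as $R\to\infty$ through odd integers, $$\rho(\alpha)=\frac14\left(1-\frac{3}{R}+\frac{4}{R^2}+O\!\left(R^{-3}\right)\right).$$
   Context: For real $x$, $\|x\|$ denotes the distance from $x$ to the nearest integer. For irrational $\alpha$ and real $\gamma$, $M(\alpha,\gamma):=\liminf_{|n|\to\infty}|n|\,\|n\alpha-\gamma\|$, and $\rho(\alpha):=\sup_{\gamma\notin\mathbb{Z}+\alpha\mathbb{Z}}M(\alpha,\gamma)$. The negative continued fraction expansion $[0;a_1,a_2,\ldots]^-$ means $\alpha=\cfrac{1}{a_1-\cfrac{1}{a_2-\cdots}}$ with integers $a_i\geq2$ generated by $\alpha_0=\alpha$, $a_{n+1}=\lceil 1/\alpha_n\rceil$, $\alpha_{n+1}=\lceil1/\alpha_n\rceil-1/\alpha_n$; an overline denotes the repeating block. *)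

(* Defs.v *)
From Stdlib Require Import Reals ZArith List Lra Lia.
From Coquelicot Require Import Coquelicot.
Open Scope R_scope.

(* floor and ceiling on R (up x is the unique integer with x < up x <= x + 1) *)
Definition zfloor (x : R) : Z := (up x - 1)%Z.
Definition zceil (x : R) : Z := (- zfloor (- x))%Z.

Definition dnint (x : R) : R :=
  Rmin (x - IZR (zfloor x)) (IZR (zceil x) - x).

Definition tail_inf (alpha gamma : R) (N : Z) : Rbar :=
  Rbar_glb (fun y => exists n : Z, (N <= Z.abs n)%Z /\
              y = Finite (IZR (Z.abs n) * dnint (IZR n * alpha - gamma))).

Definition Mag (alpha gamma : R) : Rbar :=
  Rbar_lub (fun y => exists N : Z, y = tail_inf alpha gamma N).

Definition rho (alpha : R) : Rbar :=
  Rbar_lub (fun y => exists gamma : R,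
     ~ (exists a b : Z, gamma = IZR a + IZR b * alpha) /\ y = Mag alpha gamma).

Fixpoint ncf_rem (alpha : R) (n : nat) : R :=
  match n with
  | O => alpha
  | S m => let t := / ncf_rem alpha m in IZR (zceil t) - t
  end.

(* ncf_digit alpha n = a_{n+1} = ceil(1/alpha_n) *)
Definition ncf_digit (alpha : R) (n : nat) : Z := zceil (/ ncf_rem alpha n).

Definition block (Rr : Z) : list Z :=
  (Rr :: Rr :: Rr+1 :: Rr :: Rr+1 :: Rr+1 :: Rr :: Rr+1 :: Rr+1 :: Rr :: Rr+1 :: nil)%Z.

Definition has_expansion (Rr : Z) (alpha : R) : Prop :=
  0 < alpha < 1 /\
  forall n : nat, ncf_digit alpha n = nth (n mod 11) (block Rr) 0%Z.

(* Main.v *)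
Require Import Defs.
From Stdlib Require Import Reals ZArith List Lra Lia.
From Coquelicot Require Import Coquelicot.
Open Scope R_scope.

(* Write the grid of points (n, n alpha - m - gamma) in the bases v_k = (q_k, D_k), v_(k-1) of
   convergents of the negative continued fraction. At level k there is a center c_k = c_(k-1) +
   (t_k / 2) v_(k-1), with t_k of the parity of the digit a_k, such that the grid is
   c_k + (i v_k + j v_(k-1)) / 2 with i, j odd. With d = 1/R, the products |n| |n alpha - m - gamma|
   at the two vertices i = -j = 1, -1 of level k are (1/4)(1 - b +- u)(1 - x +- w) / (1 - x b)
   with equal signs, where b ~ x ~ d, u ~ t_k d and w ~ t_(k+1) d. If all of them exceed (1 - 3 d)/4, then u and w are
   O(sqrt d), whence |t_k + t_(k+1)| <= 1. Where the digits R and R+1 meet, the parities give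
   t_k + t_(k+1) = 1 or -1; when it is -1, the expansion to second order is
     1 - 3 d + 4 d^2 + (t_(k-1) + t_(k+2) + 1 - o^2) d^2 + O(d^3)
   with o the odd one of t_k, t_(k+1), and symmetrically when it is 1. No sequence makes the
   coefficient of the correction positive throughout the block, which bounds rho from above; a
   periodic sequence with values in {-1, 0, 1} makes it nonnegative everywhere. For the
   corresponding gamma every far enough grid point is either a vertex at some level or has
   product at least 1/4, by descent to a level where |i| is least. *)

(** * Floor and nearest integer *)

Lemma zfloor_spec (x : R) : IZR (zfloor x) <= x < IZR (zfloor x) + 1.
Proof.
  unfold zfloor; rewrite minus_IZR.
  destruct (archimed x); lra.
Qed.

Lemma zceil_spec (x : R) : IZR (zceil x) - 1 < x <= IZR (zceil x).
Proof.
  unfold zceil; rewrite opp_IZR.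
  destruct (zfloor_spec (- x)); lra.
Qed.

Lemma zceil_unique (x : R) (z : Z) : IZR z - 1 < x <= IZR z -> zceil x = z.
Proof.
  intros Hz; pose proof (zceil_spec x) as Hc.
  assert (z < zceil x + 1)%Z by (apply lt_IZR; rewrite plus_IZR; lra).
  assert (zceil x < z + 1)%Z by (apply lt_IZR; rewrite plus_IZR; lra).
  lia.
Qed.

Lemma dnint_le (x : R) (m : Z) : dnint x <= Rabs (x - IZR m).
Proof.
  unfold dnint.
  pose proof (zfloor_spec x) as Hf; pose proof (zceil_spec x) as Hc.
  destruct (Rle_or_lt (IZR m) x) as [Hm | Hm].
  - apply Rle_trans with (1 := Rmin_l _ _).
    assert (m < zfloor x + 1)%Z by (apply lt_IZR; rewrite plus_IZR; lra).
    assert (IZR m <= IZR (zfloor x)) by (apply IZR_le; lia).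
    rewrite Rabs_pos_eq; lra.
  - apply Rle_trans with (1 := Rmin_r _ _).
    assert (zceil x < m + 1)%Z by (apply lt_IZR; rewrite plus_IZR; lra).
    assert (IZR (zceil x) <= IZR m) by (apply IZR_le; lia).
    rewrite Rabs_left; lra.
Qed.

Lemma dnint_attained (x : R) : exists m : Z, dnint x = Rabs (x - IZR m).
Proof.
  unfold dnint.
  pose proof (zfloor_spec x) as Hf; pose proof (zceil_spec x) as Hc.
  apply Rmin_case.
  - exists (zfloor x); rewrite Rabs_pos_eq; lra.
  - exists (zceil x); rewrite Rabs_left1; lra.
Qed.

(** * Existence of the expansion *)

(* [/ (a - Rmin x (1/2))], with the minimum written out so that continuity on the
   whole line is immediate. *)
Definition ncf_step (a : Z) (x : R) : R :=
  / (IZR a - (x + 1 / 2 - Rabs (x - 1 / 2)) / 2).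

Lemma ncf_step_denominator (a : Z) (x : R) :
  (3 <= a)%Z -> 2 < IZR a - (x + 1 / 2 - Rabs (x - 1 / 2)) / 2.
Proof.
  intros Ha; apply IZR_le in Ha.
  unfold Rabs; destruct (Rcase_abs (x - 1 / 2)); lra.
Qed.

Lemma ncf_step_bounds (a : Z) (x : R) : (3 <= a)%Z -> 0 < ncf_step a x < 1 / 2.
Proof.
  intros Ha; pose proof (ncf_step_denominator a x Ha) as H; unfold ncf_step; split.
  - apply Rinv_0_lt_compat; lra.
  - apply Rlt_le_trans with (/ 2); [| lra].
    apply Rinv_lt_contravar; [apply Rmult_lt_0_compat; lra | exact H].
Qed.

Lemma inv_ncf_step (a : Z) (x : R) : x <= 1 / 2 -> / ncf_step a x = IZR a - x.
Proof.
  intros Hx; unfold ncf_step; rewrite Rinv_inv, Rabs_left1 by lra; lra.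
Qed.

Lemma ncf_step_continuity (a : Z) : (3 <= a)%Z -> Ranalysis1.continuity (ncf_step a).
Proof.
  intros Ha x; pose proof (ncf_step_denominator a x Ha) as Hd; unfold ncf_step.
  apply (Ranalysis1.continuity_pt_inv (fun y => IZR a - (y + 1 / 2 - Rabs (y - 1 / 2)) / 2)); [| lra].
  assert (Hid : continuity_pt (fun y => y) x)
    by (apply derivable_continuous_pt, derivable_pt_id).
  assert (Hc : forall c, continuity_pt (fun _ => c) x)
    by (intros c; apply continuity_pt_const; easy).
  assert (Habs : continuity_pt (fun y => Rabs (y - 1 / 2)) x).
  { apply (continuity_pt_comp (fun y => y - 1 / 2) Rabs); [| apply Rcontinuity_abs].
    now apply (Ranalysis1.continuity_pt_minus (fun y => y) (fun _ => 1 / 2)). }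
  apply (Ranalysis1.continuity_pt_minus (fun _ => IZR a)
           (fun y => (y + 1 / 2 - Rabs (y - 1 / 2)) * / 2)); [easy |].
  apply (Ranalysis1.continuity_pt_mult (fun y => y + 1 / 2 - Rabs (y - 1 / 2)) (fun _ => / 2)); [| easy].
  apply (Ranalysis1.continuity_pt_minus (fun y => y + 1 / 2) (fun y => Rabs (y - 1 / 2))); [| easy].
  now apply (Ranalysis1.continuity_pt_plus (fun y => y) (fun _ => 1 / 2)).
Qed.

Definition ncf_steps (l : list Z) (x : R) : R := fold_right ncf_step x l.

Lemma ncf_steps_continuity (l : list Z) :
  List.Forall (fun a => (3 <= a)%Z) l -> Ranalysis1.continuity (ncf_steps l).
Proof.
  induction 1 as [| a l Ha Hl IH].
  - apply derivable_continuous, derivable_id.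
  - apply (continuity_comp (ncf_steps l) (ncf_step a)); [exact IH |].
    now apply ncf_step_continuity.
Qed.

Lemma ncf_steps_bounds (l : list Z) (x : R) :
  List.Forall (fun a => (3 <= a)%Z) l -> 0 < x < 1 / 2 -> 0 < ncf_steps l x < 1 / 2.
Proof.
  intros Hl Hx; destruct Hl as [| a l Ha Hl]; [exact Hx |].
  now apply ncf_step_bounds.
Qed.

(** The composition maps the whole line into (0, 1/2), so [x - ncf_steps l x] changes sign on
    [0, 1/2] and the intermediate value theorem applies. At the zero, the truncation built into
    [ncf_step] is inactive. *)
Lemma ncf_steps_fixed_point (l : list Z) :
  l <> nil -> List.Forall (fun a => (3 <= a)%Z) l ->
  exists x, 0 < x < 1 / 2 /\ ncf_steps l x = x.
Proof.
  intros Hnil Hl.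
  assert (Hb : forall x, 0 < ncf_steps l x < 1 / 2).
  { intros x; destruct Hl as [| a l Ha Hl]; [easy | now apply ncf_step_bounds]. }
  destruct (IVT (fun x => x - ncf_steps l x) 0 (1 / 2)) as [z [_ Hz]].
  - apply Ranalysis1.continuity_minus; [apply derivable_continuous, derivable_id |].
    now apply ncf_steps_continuity.
  - lra.
  - specialize (Hb 0); lra.
  - specialize (Hb (1 / 2)); lra.
  - exists z; specialize (Hb z); split; lra.
Qed.

(** The reciprocal of a nonempty suffix of the composition is its first digit minus a number in (0,
    1/2): the ceiling reads off that digit, and what remains is the next suffix. The fixed point
    equation closes the cycle after [length l] steps. *)
Lemma ncf_rem_fixed_point (l : list Z) (x : R) :
  l <> nil -> List.Forall (fun a => (3 <= a)%Z) l -> 0 < x < 1 / 2 -> ncf_steps l x = x ->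
  forall n, ncf_rem x n = ncf_steps (skipn (n mod length l) l) x /\
            ncf_digit x n = nth (n mod length l) l 0%Z.
Proof.
  intros Hnil Hl Hx Hfix.
  assert (Hlen : (0 < length l)%nat) by (destruct l; [easy | simpl; lia]).
  assert (Hdigit : forall n, (n < length l)%nat ->
      let y := ncf_steps (skipn n l) x in
      zceil (/ y) = nth n l 0%Z /\
      IZR (zceil (/ y)) - / y = ncf_steps (skipn (S n) l) x).
  { intros n Hn.
    assert (Hskip : skipn n l = nth n l 0%Z :: skipn (S n) l).
    { clear - Hn; revert n Hn; induction l as [| a l IH]; intros n Hn; [simpl in Hn; lia |].
      destruct n as [| n]; [reflexivity | simpl in *; rewrite IH by lia; reflexivity]. }
    cbv zeta; rewrite Hskip.
    change (ncf_steps (nth n l 0%Z :: skipn (S n) l) x)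
      with (ncf_step (nth n l 0%Z) (ncf_steps (skipn (S n) l) x)).
    assert (Hs : 0 < ncf_steps (skipn (S n) l) x < 1 / 2).
    { apply ncf_steps_bounds; [| exact Hx].
      rewrite <- (firstn_skipn (S n) l) in Hl; now apply Forall_app in Hl. }
    rewrite inv_ncf_step by lra.
    assert (Hc : zceil (IZR (nth n l 0%Z) - ncf_steps (skipn (S n) l) x) = nth n l 0%Z)
      by (apply zceil_unique; lra).
    rewrite Hc; split; [reflexivity | lra]. }
  assert (Hrem : forall n, ncf_rem x n = ncf_steps (skipn (n mod length l) l) x).
  { induction n as [| n IH].
    - rewrite Nat.Div0.mod_0_l; simpl; now rewrite Hfix.
    - simpl ncf_rem; rewrite IH.
      assert (Hn : (n mod length l < length l)%nat) by (apply Nat.mod_upper_bound; lia).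
      rewrite (proj2 (Hdigit _ Hn)).
      destruct (Nat.eq_dec (S (n mod length l)) (length l)) as [Heq | Hne].
      + assert (E : (S n mod length l = 0)%nat).
        { symmetry; apply Nat.mod_unique with (S (n / length l)); [lia |].
          pose proof (Nat.div_mod_eq n (length l)); nia. }
        rewrite E, Heq, skipn_all; simpl; now rewrite Hfix.
      + assert (E : (S n mod length l = S (n mod length l))%nat).
        { symmetry; apply Nat.mod_unique with (n / length l)%nat; [lia |].
          pose proof (Nat.div_mod_eq n (length l)); nia. }
        now rewrite E. }
  intros n; split; [apply Hrem |].
  unfold ncf_digit; rewrite Hrem.
  apply Hdigit, Nat.mod_upper_bound; lia.
Qed.

Lemma has_expansion_exists (Rr : Z) : (3 <= Rr)%Z -> exists alpha, has_expansion Rr alpha.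
Proof.
  intros HR.
  assert (Hl : List.Forall (fun a => (3 <= a)%Z) (block Rr)) by (repeat constructor; lia).
  destruct (ncf_steps_fixed_point (block Rr)) as [x [Hx Hfix]]; [easy | exact Hl |].
  exists x; split; [lra |].
  intros n.
  destruct (ncf_rem_fixed_point (block Rr) x) with (n := n) as [_ H]; easy.
Qed.

(** * The block as shifts of [Rr] by 0 or 1 *)

Definition block_shift (n : nat) : Z :=
  nth (n mod 11) (0 :: 0 :: 1 :: 0 :: 1 :: 1 :: 0 :: 1 :: 1 :: 0 :: 1 :: nil)%Z 0%Z.

Lemma mod11_cases (P : nat -> Prop) :
  P 0%nat -> P 1%nat -> P 2%nat -> P 3%nat -> P 4%nat -> P 5%nat -> P 6%nat ->
  P 7%nat -> P 8%nat -> P 9%nat -> P 10%nat -> forall n, P (n mod 11)%nat.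
Proof.
  intros H0 H1 H2 H3 H4 H5 H6 H7 H8 H9 H10 n.
  assert (Hn : (n mod 11 < 11)%nat) by (apply Nat.mod_upper_bound; lia).
  generalize dependent (n mod 11)%nat; clear n; intros n Hn.
  do 11 (destruct n as [| n]; [assumption |]); lia.
Qed.

Lemma block_digit (Rr : Z) (n : nat) :
  nth (n mod 11) (block Rr) 0%Z = (Rr + block_shift n)%Z.
Proof.
  unfold block_shift; apply (mod11_cases (fun m => nth m (block Rr) 0%Z = (Rr + nth m _ 0)%Z));
    simpl; ring.
Qed.

Lemma block_shift_cases (n : nat) : block_shift n = 0%Z \/ block_shift n = 1%Z.
Proof.
  unfold block_shift;
    apply (mod11_cases (fun m => nth m _ 0%Z = 0%Z \/ nth m _ 0%Z = 1%Z)); simpl; auto.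
Qed.

(** * Bounds for [Mag] *)

Lemma Rbar_lub_spec (E : Rbar -> Prop) : Rbar_is_lub E (Rbar_lub E).
Proof. unfold Rbar_lub; now destruct (Rbar_ex_lub E). Qed.

Lemma Rbar_glb_spec (E : Rbar -> Prop) : Rbar_is_glb E (Rbar_glb E).
Proof. unfold Rbar_glb; now destruct (Rbar_ex_glb E). Qed.

(** A tail infimum above [B] would put every product of that tail strictly above [B]. *)
Lemma Mag_le (alpha gamma B : R) :
  (forall N : Z, ~ forall n : Z, (N <= Z.abs n)%Z ->
     B < IZR (Z.abs n) * dnint (IZR n * alpha - gamma)) ->
  Rbar_le (Mag alpha gamma) (Finite B).
Proof.
  intros H; apply (proj2 (Rbar_lub_spec _)); intros y [N ->].
  destruct (Rbar_le_lt_dec (tail_inf alpha gamma N) (Finite B)) as [Hle | Hlt]; [exact Hle |].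
  exfalso; apply (H N); intros n Hn.
  assert (Hb : Rbar_le (tail_inf alpha gamma N)
                 (Finite (IZR (Z.abs n) * dnint (IZR n * alpha - gamma)))).
  { apply (proj1 (Rbar_glb_spec _)); eauto. }
  exact (Rbar_lt_le_trans _ _ _ Hlt Hb).
Qed.

Lemma Mag_ge (alpha gamma B : R) (N : Z) :
  (forall n : Z, (N <= Z.abs n)%Z ->
     B <= IZR (Z.abs n) * dnint (IZR n * alpha - gamma)) ->
  Rbar_le (Finite B) (Mag alpha gamma).
Proof.
  intros H; apply Rbar_le_trans with (tail_inf alpha gamma N).
  - apply (proj2 (Rbar_glb_spec _)); intros y [n [Hn ->]]; now apply H.
  - apply (proj1 (Rbar_lub_spec _)); eauto.
Qed.

(** Only finitely many positive values compete. The bound serves in the converse direction: a grid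
    point closer than [delta] to the axis must have |n| at least [N]. *)
Lemma dnint_pos_below (alpha gamma : R) (N : nat) :
  ~ (exists a b : Z, gamma = IZR a + IZR b * alpha) ->
  exists delta, 0 < delta /\
    forall n : Z, (Z.abs n < Z.of_nat N)%Z -> delta <= dnint (IZR n * alpha - gamma).
Proof.
  intros Hg.
  assert (Hpos : forall n, 0 < dnint (IZR n * alpha - gamma)).
  { intros n; destruct (dnint_attained (IZR n * alpha - gamma)) as [m ->].
    apply Rabs_pos_lt; intros E; apply Hg; exists (- m)%Z, n; rewrite opp_IZR; lra. }
  induction N as [| N [delta [Hd IH]]]; [exists 1; split; [lra | intros n Hn; lia] |].
  set (p := dnint (IZR (Z.of_nat N) * alpha - gamma)).
  set (q := dnint (IZR (- Z.of_nat N) * alpha - gamma)).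
  exists (Rmin delta (Rmin p q)); split.
  - apply Rmin_glb_lt; [exact Hd | apply Rmin_glb_lt; apply Hpos].
  - intros n Hn.
    destruct (Z_lt_le_dec (Z.abs n) (Z.of_nat N)) as [Hlt | Hge].
    + apply Rle_trans with (1 := Rmin_l _ _); auto.
    + apply Rle_trans with (1 := Rmin_r _ _).
      assert (n = Z.of_nat N \/ n = (- Z.of_nat N)%Z) as [-> | ->] by lia.
      * apply Rmin_l.
      * apply Rmin_r.
Qed.

(** * Estimates at one level *)

Lemma Rabs_mult_le (a b x y : R) : Rabs a <= x -> Rabs b <= y -> Rabs (a * b) <= x * y.
Proof.
  intros Ha Hb; rewrite Rabs_mult; apply Rmult_le_compat; auto using Rabs_pos.
Qed.

(** The product of the two right-hand sides is |A A'| with A = (1 - b)^2 - u^2 and A' = (1 - x)^2 -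
    w^2. Both lie in [-1/2, 1] while |A A'| is at least 1 - 7 d, so each is at least 1 - 7 d, which
    leaves no room for a large u or w. *)
Lemma displacement_small (d b x u w : R) :
  0 < d <= / 1000 -> 0 <= b <= 2 * d -> 0 <= x <= 2 * d ->
  Rabs u <= 1 + 4 * d -> Rabs w <= 1 + 4 * d ->
  (1 - 3 * d) * (1 - x * b) <= Rabs ((1 - b + u) * (1 - x + w)) ->
  (1 - 3 * d) * (1 - x * b) <= Rabs ((1 - b - u) * (1 - x - w)) ->
  u ^ 2 <= 8 * d /\ w ^ 2 <= 8 * d.
Proof.
  intros Hd Hb Hx Hu Hw H1 H2.
  assert (Hxb : x * b <= (2 * d) * (2 * d)) by (apply Rmult_le_compat; lra).
  assert (Hdd : d * d <= d * / 1000) by (apply Rmult_le_compat_l; lra).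
  assert (Hthr : 1 - 32 / 10 * d <= (1 - 3 * d) * (1 - x * b)) by nra.
  set (A := (1 - b) ^ 2 - u ^ 2); set (A' := (1 - x) ^ 2 - w ^ 2).
  assert (HAA : 1 - 7 * d <= Rabs A * Rabs A').
  { rewrite <- Rabs_mult.
    replace (A * A') with (((1 - b + u) * (1 - x + w)) * ((1 - b - u) * (1 - x - w)))
      by (unfold A, A'; ring).
    rewrite Rabs_mult.
    apply Rle_trans with ((1 - 32 / 10 * d) * (1 - 32 / 10 * d)); [nra |].
    apply Rmult_le_compat; lra. }
  assert (Hlow : forall c v, 0 <= c <= 2 * d -> Rabs v <= 1 + 4 * d ->
            - / 2 <= (1 - c) ^ 2 - v ^ 2 <= 1 - v ^ 2).
  { intros c v Hc Hv; apply Rabs_le_between in Hv; split; [| nra].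
    assert (v ^ 2 <= (1 + 4 * d) ^ 2) by nra.
    assert ((1 - 2 * d) ^ 2 <= (1 - c) ^ 2) by nra.
    nra. }
  destruct (Hlow b u Hb Hu) as [HA1 HA2]; destruct (Hlow x w Hx Hw) as [HA1' HA2'].
  fold A in HA1, HA2; fold A' in HA1', HA2'.
  pose proof (pow2_ge_0 u); pose proof (pow2_ge_0 w).
  assert (HA : Rabs A <= 1) by (apply Rabs_le; lra).
  assert (HA' : Rabs A' <= 1) by (apply Rabs_le; lra).
  pose proof (Rabs_pos A); pose proof (Rabs_pos A').
  assert (G : 1 - 7 * d <= Rabs A) by nra.
  assert (G' : 1 - 7 * d <= Rabs A') by nra.
  revert G G'; unfold Rabs; destruct (Rcase_abs A), (Rcase_abs A'); lra.
Qed.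

(** Here [e] is the square root of [d]. With s = u + w, expanding both products gives |s| <= d + u w
    + O(d e). Since u w <= s^2 / 4 and |s| <= 6 e, the quadratic term is absorbed by a factor 1 - 3
    e / 2 on the left. *)
Lemma displacement_sum_small (d e b x u w : R) :
  0 < e <= / 1000 -> d = e * e -> Rabs (b - d) <= 2 * d ^ 2 -> Rabs (x - d) <= 2 * d ^ 2 ->
  Rabs u <= 3 * e -> Rabs w <= 3 * e ->
  (1 - 3 * d) * (1 - x * b) <= (1 - b + u) * (1 - x + w) ->
  (1 - 3 * d) * (1 - x * b) <= (1 - b - u) * (1 - x - w) ->
  Rabs (u + w) <= d * (1 + 20 * e).
Proof.
  intros He Hd Hb Hx Hu Hw H1 H2.
  assert (Hd0 : 0 < d) by (subst; nra).
  assert (Hde : d <= e / 1000) by (subst; nra).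
  apply Rabs_le_between in Hb, Hx, Hu, Hw.
  assert (Hdd : d ^ 2 <= d * (e / 1000)) by nra.
  assert (Hd2 : 0 < d ^ 2) by nra.
  assert (Hed : 0 < d * e) by nra.
  assert (Hb' : 0 <= b <= 2 * d) by (split; nra).
  assert (Hx' : 0 <= x <= 2 * d) by (split; nra).
  assert (Hxb : 0 <= x * b <= 4 * (d * (e / 1000))) by (split; nra).
  assert (Hbw : Rabs (b * w) <= (2 * d) * (3 * e)).
  { apply Rabs_mult_le; apply Rabs_le; lra. }
  assert (Hxu : Rabs (x * u) <= (2 * d) * (3 * e)).
  { apply Rabs_mult_le; apply Rabs_le; lra. }
  apply Rabs_le_between in Hbw, Hxu.
  assert (Hdxb : 0 <= d * (x * b) <= d * (e / 1000)).
  { split; [nra |]. apply Rmult_le_compat_l; nra. }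
  assert (G1 : - d - 14 * (d * e) <= (u + w) + u * w).
  { replace ((1 - b + u) * (1 - x + w)) with
      (1 - b - x + x * b + (u + w) + u * w - b * w - x * u) in H1 by ring.
    replace ((1 - 3 * d) * (1 - x * b)) with (1 - 3 * d - x * b + 3 * (d * (x * b))) in H1 by ring.
    lra. }
  assert (G2 : - d - 14 * (d * e) <= - (u + w) + u * w).
  { replace ((1 - b - u) * (1 - x - w)) with
      (1 - b - x + x * b - (u + w) + u * w + b * w + x * u) in H2 by field.
    replace ((1 - 3 * d) * (1 - x * b)) with (1 - 3 * d - x * b + 3 * (d * (x * b))) in H2 by field.
    lra. }
  assert (Huw : u * w <= (u + w) * (u + w) / 4)
    by (pose proof (pow2_ge_0 (u - w)) as Hsq; clear - Hsq; lra).
  set (s := u + w) in *.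
  assert (Hs : - (6 * e) <= s <= 6 * e) by (unfold s; lra).
  apply Rabs_le.
  assert (Hdee : d * e * e <= d * e * / 1000) by (apply Rmult_le_compat_l; lra).
  split; apply Rnot_lt_le; intros Hc.
  - assert (- s * - s <= - s * (6 * e)) by (apply Rmult_le_compat_l; nra).
    assert (s * (1 - 3 / 2 * e) <= - (d * (1 + 20 * e)) * (1 - 3 / 2 * e))
      by (apply Rmult_le_compat_r; lra).
    lra.
  - assert (s * s <= s * (6 * e)) by (apply Rmult_le_compat_l; nra).
    assert (d * (1 + 20 * e) * (1 - 3 / 2 * e) <= s * (1 - 3 / 2 * e))
      by (apply Rmult_le_compat_r; lra).
    lra.
Qed.

(** Adding the two digit equations gives t + s = R (u + w) + O(e), and R times the bound on u + w is
    1 + 20 e. *)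
Lemma digit_sum_small (Rr d e eps eps' b' x' u u' w w' t s : R) :
  0 < e <= / 1000 -> d = e * e -> Rr * d = 1 -> 0 <= eps <= 1 -> 0 <= eps' <= 1 ->
  0 <= b' <= 1 -> 0 <= x' <= 1 ->
  Rabs u <= 3 * e -> Rabs w <= 3 * e -> Rabs u' <= 3 * e -> Rabs w' <= 3 * e ->
  u * (Rr + eps - b') = t + u' -> w * (Rr + eps' - x') = s + w' ->
  Rabs (u + w) <= d * (1 + 20 * e) -> Rabs (t + s) < 2.
Proof.
  intros He Hd HR He1 He2 Hb Hx Hu Hw Hu' Hw' Ht Hs Hsum.
  assert (HR0 : 0 < Rr).
  { assert (0 < d) by (subst; nra). nra. }
  assert (E : t + s = Rr * (u + w) + u * (eps - b') + w * (eps' - x') - u' - w') by nra.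
  assert (H1 : Rabs (Rr * (u + w)) <= 1 + 20 * e).
  { rewrite Rabs_mult, (Rabs_pos_eq Rr) by lra.
    apply Rle_trans with (Rr * (d * (1 + 20 * e))); [apply Rmult_le_compat_l; lra |].
    rewrite <- Rmult_assoc, HR; lra. }
  assert (H2 : Rabs (u * (eps - b')) <= 3 * e * 1)
    by (apply Rabs_mult_le; [lra | apply Rabs_le; lra]).
  assert (H3 : Rabs (w * (eps' - x')) <= 3 * e * 1)
    by (apply Rabs_mult_le; [lra | apply Rabs_le; lra]).
  apply Rabs_le_between in H1, H2, H3, Hu', Hw'.
  rewrite E; apply Rabs_def1; lra.
Qed.

(* [/ (R + eps - b)] to second order in [d = 1/R]. *)
Lemma reciprocal_expansion (Rr d eps b c : R) :
  0 < d <= / 1000 -> Rr * d = 1 -> 0 <= eps <= 1 -> 0 <= b <= 2 * d ->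
  c * (Rr + eps - b) = 1 ->
  Rabs (c - d) <= 2 * d ^ 2 /\ Rabs (c - d + eps * d ^ 2) <= 7 * d ^ 3.
Proof.
  intros Hd HR He Hb Hc.
  assert (HR0 : 1000 <= Rr) by nra.
  assert (Hc0 : 0 < c) by nra.
  assert (E : c - d = d * c * (b - eps)).
  { replace (c - d) with (c * (Rr * d) - d * (c * (Rr + eps - b))) by (rewrite HR, Hc; ring).
    ring. }
  assert (Hc1 : c <= 101 / 100 * d).
  { apply Rmult_le_reg_r with (Rr + eps - b); [lra |]. rewrite Hc.
    apply Rle_trans with (101 / 100 * d * (Rr - 2 * d)); [nra |].
    apply Rmult_le_compat_l; lra. }
  assert (Hdc : 0 <= d * c <= d * (101 / 100 * d)) by (split; [nra | apply Rmult_le_compat_l; lra]).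
  assert (H1 : Rabs (c - d) <= 101 / 100 * d ^ 2).
  { rewrite E.
    replace (101 / 100 * d ^ 2) with (d * (101 / 100 * d) * 1) by ring.
    apply Rabs_mult_le; [rewrite Rabs_pos_eq by lra; lra | apply Rabs_le; lra]. }
  split; [pose proof (pow2_ge_0 d); lra |].
  replace (c - d + eps * d ^ 2) with (d * c * b + (eps * d) * - (c - d)) by lra.
  assert (H2 : Rabs (d * c * b) <= d * (101 / 100 * d) * (2 * d)).
  { apply Rabs_mult_le; rewrite Rabs_pos_eq; lra. }
  assert (H3 : Rabs (eps * d * - (c - d)) <= (1 * d) * (101 / 100 * d ^ 2)).
  { apply Rabs_mult_le; [| rewrite Rabs_Ropp; lra].
    apply Rabs_mult_le; rewrite Rabs_pos_eq; lra. }
  apply Rle_trans with (1 := Rabs_triang _ _).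
  assert (0 < d ^ 3) by (apply pow_lt; lra).
  replace (d * (101 / 100 * d) * (2 * d)) with (202 / 100 * d ^ 3) in H2 by field.
  replace (1 * d * (101 / 100 * d ^ 2)) with (101 / 100 * d ^ 3) in H3 by field.
  lra.
Qed.

(** Here [u] and [w] are the displacements beyond the digits [t] and [s], with leading terms [d * p]
    and [d * q]. The size [T] of the digits stays explicit in the error because no absolute bound on
    the digits is known when the upper bound is proved. *)
Lemma vertex_expansion (d T eps eps' b x t s p q u w : R) :
  0 < d <= / 1000 -> 1 <= T -> 0 <= eps <= 1 -> 0 <= eps' <= 1 ->
  Rabs (b - d) <= 2 * d ^ 2 -> Rabs (b - d + eps * d ^ 2) <= 7 * d ^ 3 ->
  Rabs (x - d) <= 2 * d ^ 2 -> Rabs (x - d + eps' * d ^ 2) <= 7 * d ^ 3 ->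
  Rabs t <= T -> Rabs s <= T -> Rabs p <= 2 * T -> Rabs q <= 2 * T -> t + s = -1 ->
  Rabs (u - d * p) <= 40 * T * d ^ 2 -> Rabs (w - d * q) <= 40 * T * d ^ 2 ->
  Rabs ((1 - b * (1 - t - u)) * (1 - x * (1 - s - w)) - (1 - x * b) * (1 - 3 * d + 4 * d ^ 2)
        - d ^ 2 * (p + q + eps * (1 - t) + eps' * (1 - s) + (1 - t) * (1 - s) - 3))
    <= 300 * T ^ 2 * d ^ 3.
Proof.
  intros Hd HT He He' Hb Hb2 Hx Hx2 Ht Hs Hp Hq Hts Hu Hw.
  assert (Hd2 : 0 < d ^ 2 <= d / 1000) by (split; nra).
  assert (Hd3 : 0 < d ^ 3) by (apply pow_lt; lra).
  assert (Hd4 : d ^ 4 <= d ^ 3 / 1000) by nra.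
  assert (HT2 : T <= T ^ 2) by nra.
  set (X := T ^ 2 * d ^ 3).
  assert (HX1 : T * d ^ 3 <= X) by (unfold X; nra).
  assert (HX2 : d ^ 3 <= X) by (unfold X; nra).
  assert (HTd : 0 < T * d) by nra.
  assert (HTd2 : T * d ^ 2 <= T * d / 1000) by nra.
  assert (small : forall v r, Rabs r <= 2 * T -> Rabs (v - d * r) <= 40 * T * d ^ 2 ->
                         Rabs v <= 3 * T * d).
  { intros v r Hr Hv.
    replace v with (d * r + (v - d * r)) by ring.
    apply Rle_trans with (1 := Rabs_triang _ _).
    assert (Rabs (d * r) <= d * (2 * T)) by (apply Rabs_mult_le; [rewrite Rabs_pos_eq; lra | lra]).
    nra. }
  pose proof (small u p Hp Hu) as Hu1; pose proof (small w q Hq Hw) as Hw1.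
  assert (factor : forall v r, Rabs r <= T -> Rabs (1 - r) <= 2 * T /\
                     (Rabs v <= 3 * T * d -> Rabs (1 - r - v) <= 201 / 100 * T)).
  { intros v r Hr; apply Rabs_le_between in Hr; split; [apply Rabs_le; lra |].
    intros Hv; apply Rabs_le_between in Hv; apply Rabs_le.
    assert (3 * T * d <= / 100 * T) by nra. lra. }
  destruct (factor u t Ht) as [HP0 HP]; specialize (HP Hu1).
  destruct (factor w s Hs) as [HQ0 HQ]; specialize (HQ Hw1).
  assert (Hbx : Rabs (b * x - d ^ 2) <= 5 * d ^ 3).
  { replace (b * x - d ^ 2) with ((b - d) * x + d * (x - d)) by ring.
    apply Rle_trans with (1 := Rabs_triang _ _).
    assert (Hx3 : Rabs x <= 101 / 100 * d).
    { apply Rabs_le_between in Hx; apply Rabs_le; nra. }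
    pose proof (Rabs_mult_le _ _ _ _ Hb Hx3).
    assert (Hdd : Rabs d <= d) by (rewrite Rabs_pos_eq; lra).
    pose proof (Rabs_mult_le _ _ _ _ Hdd Hx).
    nra. }
  set (P := 1 - t - u) in *; set (Q := 1 - s - w) in *.
  set (P0 := 1 - t) in *; set (Q0 := 1 - s) in *.
  set (e1 := b - d + eps * d ^ 2) in *; set (e2 := x - d + eps' * d ^ 2) in *.
  assert (HPQ : Rabs (P * Q + 1 - 3 * d + 4 * d ^ 2) <= 6 * T ^ 2).
  { pose proof (Rabs_mult_le _ _ _ _ HP HQ) as H; apply Rabs_le_between in H; apply Rabs_le; nra. }
  assert (HPQ' : Rabs (- (u * Q0) - w * P0 + u * w - 3 * d + 4 * d ^ 2) <= 16 * T ^ 2 * d).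
  { pose proof (Rabs_mult_le _ _ _ _ Hu1 HQ0) as H1.
    pose proof (Rabs_mult_le _ _ _ _ Hw1 HP0) as H2.
    pose proof (Rabs_mult_le _ _ _ _ Hu1 Hw1) as H3.
    apply Rabs_le_between in H1, H2, H3.
    assert (0 < T ^ 2 * d) by nra.
    assert (T ^ 2 * d ^ 2 <= T ^ 2 * d / 1000) by nra.
    assert (1 * d <= T ^ 2 * d) by (apply Rmult_le_compat_r; lra).
    apply Rabs_le; lra. }
  (* First-order terms cancel because (1 - t) + (1 - s) = 3. Each of the eight terms that remain is
     of order d^3. *)
  replace (_ - _ - _) with
    (d * (u - d * p) + d * (w - d * q) - (eps * d ^ 2) * u - (eps' * d ^ 2) * w
     - e1 * P - e2 * Q + (b * x - d ^ 2) * (P * Q + 1 - 3 * d + 4 * d ^ 2)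
     + d ^ 2 * (- (u * Q0) - w * P0 + u * w - 3 * d + 4 * d ^ 2))
    by (unfold P, Q, P0, Q0, e1, e2; replace s with (-1 - t) by lra; ring).
  assert (Hdd : Rabs d <= d) by (rewrite Rabs_pos_eq; lra).
  assert (Hdd2 : Rabs (d ^ 2) <= d ^ 2) by (rewrite Rabs_pos_eq; lra).
  assert (Hed : Rabs (eps * d ^ 2) <= 1 * d ^ 2)
    by (apply Rabs_mult_le; [rewrite Rabs_pos_eq; lra | lra]).
  assert (Hed' : Rabs (eps' * d ^ 2) <= 1 * d ^ 2)
    by (apply Rabs_mult_le; [rewrite Rabs_pos_eq; lra | lra]).
  pose proof (Rabs_mult_le _ _ _ _ Hdd Hu) as B1.
  pose proof (Rabs_mult_le _ _ _ _ Hdd Hw) as B2.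
  pose proof (Rabs_mult_le _ _ _ _ Hed Hu1) as B3.
  pose proof (Rabs_mult_le _ _ _ _ Hed' Hw1) as B4.
  pose proof (Rabs_mult_le _ _ _ _ Hb2 HP) as B5.
  pose proof (Rabs_mult_le _ _ _ _ Hx2 HQ) as B6.
  pose proof (Rabs_mult_le _ _ _ _ Hbx HPQ) as B7.
  pose proof (Rabs_mult_le _ _ _ _ Hdd2 HPQ') as B8.
  apply Rabs_le_between in B1, B2, B3, B4, B5, B6, B7, B8.
  replace (d * (40 * T * d ^ 2)) with (40 * (T * d ^ 3)) in B1, B2 by ring.
  replace (1 * d ^ 2 * (3 * T * d)) with (3 * (T * d ^ 3)) in B3, B4 by ring.
  replace (7 * d ^ 3 * (201 / 100 * T)) with (1407 / 100 * (T * d ^ 3)) in B5, B6 by field.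
  replace (5 * d ^ 3 * (6 * T ^ 2)) with (30 * X) in B7 by (unfold X; ring).
  replace (d ^ 2 * (16 * T ^ 2 * d)) with (16 * X) in B8 by (unfold X; ring).
  replace (300 * T ^ 2 * d ^ 3) with (300 * X) by (unfold X; ring).
  apply Rabs_le; split; lra.
Qed.

(** Unrolling the recursion twice leaves (b - d) p + b b' (p' + u''), both of order T d^2. *)
Lemma tail_expansion (d T b b' p p' u u' u'' : R) :
  0 < d <= / 1000 -> 1 <= T -> Rabs (b - d) <= 2 * d ^ 2 -> 0 <= b <= 2 * d ->
  0 <= b' <= 2 * d -> Rabs p <= 2 * T -> Rabs p' <= 2 * T ->
  u = b * (p + u') -> u' = b' * (p' + u'') -> Rabs u'' <= 1 ->
  Rabs (u - d * p) <= 40 * T * d ^ 2.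
Proof.
  intros Hd HT Hbd Hb Hb' Hp Hp' -> -> Hu''.
  replace (b * (p + b' * (p' + u'')) - d * p) with ((b - d) * p + b * (b' * (p' + u''))) by ring.
  apply Rle_trans with (1 := Rabs_triang _ _).
  pose proof (Rabs_mult_le _ _ _ _ Hbd Hp) as H1.
  assert (H2 : Rabs (p' + u'') <= 3 * T) by (apply Rle_trans with (1 := Rabs_triang _ _); lra).
  assert (Hb2 : Rabs b <= 2 * d) by (rewrite Rabs_pos_eq; lra).
  assert (Hb2' : Rabs b' <= 2 * d) by (rewrite Rabs_pos_eq; lra).
  pose proof (Rabs_mult_le _ _ _ _ Hb2 (Rabs_mult_le _ _ _ _ Hb2' H2)) as H3.
  assert (0 <= T * d ^ 2) by (pose proof (pow2_ge_0 d); nra).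
  lra.
Qed.

Lemma Zabs_Rabs_le (z : Z) (c : R) : IZR (Z.abs z) <= c -> Rabs (IZR z) <= c.
Proof. now rewrite abs_IZR. Qed.

Lemma square_small (d : R) : 0 < d <= / 1000000 -> 0 < d ^ 2 <= d / 1000000.
Proof. intros Hd; split; nra. Qed.

Lemma cube_small (d : R) : 0 < d <= / 1000000 -> 0 < d ^ 3 <= d ^ 2 / 1000000.
Proof. intros Hd; pose proof (square_small d Hd); split; nra. Qed.

(* [T = |o| + 3] dominates all digits involved, so the error [300 T^2 d^3] first bounds [o], and
   then is beaten by the excess [10000 d^3]. *)
Lemma boundary_digits_neg (d b x b1 b2 x1 x2 u1 u2 u3 w1 w2 w3 : R)
    (eps eps' t s p q p' q' o : Z) :
  0 < d <= / 1000000 ->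
  Rabs (b - d) <= 2 * d ^ 2 -> Rabs (b - d + IZR eps * d ^ 2) <= 7 * d ^ 3 ->
  Rabs (x - d) <= 2 * d ^ 2 -> Rabs (x - d + IZR eps' * d ^ 2) <= 7 * d ^ 3 ->
  Rabs (b1 - d) <= 2 * d ^ 2 -> 0 <= b1 <= 2 * d -> 0 <= b2 <= 2 * d ->
  Rabs (x1 - d) <= 2 * d ^ 2 -> 0 <= x1 <= 2 * d -> 0 <= x2 <= 2 * d ->
  u1 = b1 * (IZR p + u2) -> u2 = b2 * (IZR p' + u3) -> Rabs u3 <= 1 ->
  w1 = x1 * (IZR q + w2) -> w2 = x2 * (IZR q' + w3) -> Rabs w3 <= 1 ->
  (Z.abs (p + t) <= 1)%Z -> (Z.abs (q + s) <= 1)%Z ->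
  (Z.abs (p' + p) <= 1)%Z -> (Z.abs (q' + q) <= 1)%Z ->
  (t + s = -1)%Z -> Z.odd o = true ->
  (eps = 0 /\ eps' = 1 /\ o = t \/ eps = 1 /\ eps' = 0 /\ o = s)%Z ->
  (1 - 3 * d + 4 * d ^ 2 + 10000 * d ^ 3) * (1 - x * b)
    <= (1 - b + b * (IZR t + u1)) * (1 - x + x * (IZR s + w1)) ->
  (o * o = 1 /\ 1 <= p + q)%Z.
Proof.
  intros Hd Hb Hb' Hx Hx' Hb1 Hb1' Hb2 Hx1 Hx1' Hx2 Hu1 Hu2 Hu3 Hw1 Hw2 Hw3
         Hpt Hqs Hpp Hqq Hts Ho Heps Hmain.
  assert (Hd2 : 0 < d ^ 2 <= d / 1000000) by (apply square_small; exact Hd).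
  set (T := IZR (Z.abs o + 3)).
  assert (HT : 1 <= T) by (apply IZR_le; lia).
  assert (HTT : 2 * T = IZR (2 * (Z.abs o + 3))) by (rewrite mult_IZR; reflexivity).
  assert (Hd' : 0 < d <= / 1000) by lra.
  assert (Heps01 : 0 <= IZR eps <= 1 /\ 0 <= IZR eps' <= 1)
    by (destruct Heps as [(-> & -> & _) | (-> & -> & _)]; lra).
  assert (Hsmall : forall z, (Z.abs z <= 2 * (Z.abs o + 3))%Z -> Rabs (IZR z) <= 2 * T)
    by (intros z Hz; rewrite HTT; apply Zabs_Rabs_le, IZR_le, Hz).
  assert (Hu : Rabs (u1 - d * IZR p) <= 40 * T * d ^ 2).
  { apply (tail_expansion d T b1 b2 (IZR p) (IZR p') u1 u2 u3); auto; apply Hsmall;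
      destruct Heps as [(_ & _ & ->) | (_ & _ & ->)]; lia. }
  assert (Hw : Rabs (w1 - d * IZR q) <= 40 * T * d ^ 2).
  { apply (tail_expansion d T x1 x2 (IZR q) (IZR q') w1 w2 w3); auto; apply Hsmall;
      destruct Heps as [(_ & _ & ->) | (_ & _ & ->)]; lia. }
  assert (HTsmall : forall z, (Z.abs z <= Z.abs o + 3)%Z -> Rabs (IZR z) <= T)
    by (intros z Hz; apply Zabs_Rabs_le, IZR_le, Hz).
  assert (E := vertex_expansion d T (IZR eps) (IZR eps') b x (IZR t) (IZR s) (IZR p) (IZR q)
                 u1 w1 Hd' HT (proj1 Heps01) (proj2 Heps01) Hb Hb' Hx Hx').
  specialize (E ltac:(apply HTsmall; destruct Heps as [(_ & _ & ->) | (_ & _ & ->)]; lia)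
                ltac:(apply HTsmall; destruct Heps as [(_ & _ & ->) | (_ & _ & ->)]; lia)
                ltac:(apply Hsmall; destruct Heps as [(_ & _ & ->) | (_ & _ & ->)]; lia)
                ltac:(apply Hsmall; destruct Heps as [(_ & _ & ->) | (_ & _ & ->)]; lia)
                ltac:(rewrite <- plus_IZR, Hts; reflexivity) Hu Hw).
  (* If eps = 0, eps' = 1 and s = -1 - t, then (1 - s) + (1 - t)(1 - s) - 3 = (2 + t)(2 - t) - 3 = 1
     - t^2. The other orientation is the mirror image. *)
  replace (IZR p + IZR q + IZR eps * (1 - IZR t) + IZR eps' * (1 - IZR s)
           + (1 - IZR t) * (1 - IZR s) - 3) with (IZR (p + q + 1 - o * o)) in E.
  2: { repeat rewrite ?minus_IZR, ?plus_IZR, ?mult_IZR.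
       destruct Heps as [(-> & -> & ->) | (-> & -> & ->)].
       - replace s with (- 1 - t)%Z by lia; rewrite minus_IZR; ring.
       - replace t with (- 1 - s)%Z by lia; rewrite minus_IZR; ring. }
  apply Rabs_le_between in E; destruct E as [_ E].
  assert (Hd3 : d ^ 3 = d ^ 2 * d) by ring.
  assert (Hd30 : 0 < d ^ 3) by (apply pow_lt; lra).
  assert (Hxb : x * b <= / 2).
  { apply Rabs_le_between in Hb, Hx.
    apply Rle_trans with ((2 * d) * (2 * d)); [apply Rmult_le_compat |]; lra. }
  assert (Hgap : 10000 * d ^ 3 * / 2 <= 10000 * d ^ 3 * (1 - x * b))
    by (apply Rmult_le_compat_l; lra).
  assert (Hkey : 5000 * d - 300 * T ^ 2 * d <= IZR (p + q + 1 - o * o)).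
  { apply Rmult_le_reg_l with (d ^ 2); [apply Hd2 |].
    rewrite Hd3 in *.
    replace (1 - b * (1 - IZR t - u1)) with (1 - b + b * (IZR t + u1)) in E by ring.
    replace (1 - x * (1 - IZR s - w1)) with (1 - x + x * (IZR s + w1)) in E by ring.
    lra. }
  assert (Ho3 : (o * o <= 4)%Z).
  { assert (HoT : T ^ 2 <= IZR (2 * (o * o) + 18)).
    { unfold T; rewrite <- Rsqr_pow2; unfold Rsqr; rewrite <- mult_IZR; apply IZR_le.
      assert (Habs : (Z.abs o * Z.abs o = o * o)%Z) by (rewrite <- Z.abs_mul; lia).
      pose proof (Z.square_nonneg (Z.abs o - 3)) as Hsq.
      clear - Habs Hsq; lia. }
    assert (Hpq : (p + q <= 3)%Z) by lia.
    apply IZR_le in Hpq.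
    rewrite minus_IZR, !plus_IZR in Hkey; rewrite plus_IZR in Hpq.
    rewrite plus_IZR, !mult_IZR in HoT.
    assert (Hoo : IZR (o * o) < 5); [| apply lt_IZR in Hoo; lia].
    rewrite mult_IZR in *.
    assert (0 <= IZR o * IZR o) by apply Rle_0_sqr.
    assert (T ^ 2 * d <= (2 * (IZR o * IZR o) + 18) * / 1000000).
    { apply Rmult_le_compat; lra || apply pow2_ge_0. }
    lra. }
  assert (Ho1 : (o = 1 \/ o = -1)%Z).
  { assert (-2 <= o <= 2)%Z by nia.
    assert (o <> 0 /\ o <> 2 /\ o <> -2)%Z by (repeat split; intros ->; discriminate).
    lia. }
  (* Now 300 T^2 = 4800 is below 5000, half of the excess constant, so the integer coefficient is
     positive. *)
  assert (HT4 : T = 4) by (unfold T; destruct Ho1 as [-> | ->]; simpl; reflexivity).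
  rewrite HT4 in Hkey.
  assert (Hpos : 0 < IZR (p + q + 1 - o * o)) by lra.
  apply lt_IZR in Hpos.
  destruct Ho1 as [-> | ->]; lia.
Qed.

(** Negating all digits and displacements exchanges the two vertices, which reduces t + s = 1 to t +
    s = -1. *)
Lemma boundary_digits (d b x b1 b2 x1 x2 u u1 u2 u3 w w1 w2 w3 : R)
    (eps eps' t s p q p' q' o : Z) :
  0 < d <= / 1000000 ->
  Rabs (b - d) <= 2 * d ^ 2 -> Rabs (b - d + IZR eps * d ^ 2) <= 7 * d ^ 3 ->
  Rabs (x - d) <= 2 * d ^ 2 -> Rabs (x - d + IZR eps' * d ^ 2) <= 7 * d ^ 3 ->
  Rabs (b1 - d) <= 2 * d ^ 2 -> 0 <= b1 <= 2 * d -> 0 <= b2 <= 2 * d ->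
  Rabs (x1 - d) <= 2 * d ^ 2 -> 0 <= x1 <= 2 * d -> 0 <= x2 <= 2 * d ->
  u = b * (IZR t + u1) -> u1 = b1 * (IZR p + u2) -> u2 = b2 * (IZR p' + u3) -> Rabs u3 <= 1 ->
  w = x * (IZR s + w1) -> w1 = x1 * (IZR q + w2) -> w2 = x2 * (IZR q' + w3) -> Rabs w3 <= 1 ->
  (Z.abs (p + t) <= 1)%Z -> (Z.abs (q + s) <= 1)%Z ->
  (Z.abs (p' + p) <= 1)%Z -> (Z.abs (q' + q) <= 1)%Z ->
  (Z.abs (t + s) = 1)%Z -> Z.odd o = true ->
  (eps = 0 /\ eps' = 1 /\ o = t \/ eps = 1 /\ eps' = 0 /\ o = s)%Z ->
  (1 - 3 * d + 4 * d ^ 2 + 10000 * d ^ 3) * (1 - x * b) <= (1 - b + u) * (1 - x + w) ->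
  (1 - 3 * d + 4 * d ^ 2 + 10000 * d ^ 3) * (1 - x * b) <= (1 - b - u) * (1 - x - w) ->
  ((o = 1 \/ o = -1) /\ (t + s) * (p + q) <= -1)%Z.
Proof.
  intros Hd Hb Hb' Hx Hx' Hb1 Hb1' Hb2 Hx1 Hx1' Hx2 Hu Hu1 Hu2 Hu3 Hw Hw1 Hw2 Hw3
         Hpt Hqs Hpp Hqq Hts Ho Heps H1 H2.
  assert (Hts' : (t + s = -1 \/ - t + - s = -1)%Z) by lia.
  assert (Hunit : (o * o = 1 -> o = 1 \/ o = -1)%Z) by nia.
  destruct Hts' as [Hm | Hp].
  - subst u w.
    destruct (boundary_digits_neg d b x b1 b2 x1 x2 u1 u2 u3 w1 w2 w3 eps eps' t s p q p' q' o)
      as [Ho1 Hpq]; auto.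
    rewrite Hm; split; [auto | lia].
  - destruct (boundary_digits_neg d b x b1 b2 x1 x2 (- u1) (- u2) (- u3) (- w1) (- w2) (- w3)
                eps eps' (- t) (- s) (- p) (- q) (- p') (- q') (- o)) as [Ho1 Hpq];
      auto; rewrite ?opp_IZR, ?Rabs_Ropp; auto; try (subst; ring); try lia.
    + now rewrite Z.odd_opp.
    + replace (1 - b + b * (- IZR t + - u1)) with (1 - b - u) by (rewrite Hu; ring).
      replace (1 - x + x * (- IZR s + - w1)) with (1 - x - w) by (rewrite Hw; ring).
      exact H2.
Qed.

(** If t + s >= 0, the first-order loss is at most 2.02 d, well below 3 d. If t + s = -1, the
    second-order coefficient is nonnegative and only the error 300 d^3 is lost; the constant 600
    covers it because 1 - x b is at least 1/2. *)
Lemma near_vertex_lower (d b x b1 b2 x1 x2 u1 u2 u3 w1 w2 w3 : R)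
    (eps eps' t s p q p' q' : Z) :
  0 < d <= / 1000000 ->
  (eps = 0 \/ eps = 1)%Z -> (eps' = 0 \/ eps' = 1)%Z ->
  Rabs (b - d) <= 2 * d ^ 2 -> Rabs (b - d + IZR eps * d ^ 2) <= 7 * d ^ 3 ->
  Rabs (x - d) <= 2 * d ^ 2 -> Rabs (x - d + IZR eps' * d ^ 2) <= 7 * d ^ 3 ->
  Rabs (b1 - d) <= 2 * d ^ 2 -> 0 <= b1 <= 2 * d -> 0 <= b2 <= 2 * d ->
  Rabs (x1 - d) <= 2 * d ^ 2 -> 0 <= x1 <= 2 * d -> 0 <= x2 <= 2 * d ->
  u1 = b1 * (IZR p + u2) -> u2 = b2 * (IZR p' + u3) -> Rabs u3 <= 1 ->
  w1 = x1 * (IZR q + w2) -> w2 = x2 * (IZR q' + w3) -> Rabs w3 <= 1 ->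
  (Z.abs t <= 1)%Z -> (Z.abs s <= 1)%Z -> (Z.abs p <= 1)%Z -> (Z.abs q <= 1)%Z ->
  (Z.abs p' <= 1)%Z -> (Z.abs q' <= 1)%Z ->
  (0 <= t + s \/ t + s = -1 /\ 3 <= p + q + eps * (1 - t) + eps' * (1 - s) + (1 - t) * (1 - s))%Z ->
  (1 - 3 * d + 4 * d ^ 2 - 600 * d ^ 3) * (1 - x * b)
    <= (1 - b + b * (IZR t + u1)) * (1 - x + x * (IZR s + w1)).
Proof.
  intros Hd He He' Hb Hb' Hx Hx' Hb1 Hb1' Hb2 Hx1 Hx1' Hx2 Hu1 Hu2 Hu3 Hw1 Hw2 Hw3
         Ht Hs Hp Hq Hp' Hq' Hcase.
  assert (Hz : forall z, (Z.abs z <= 1)%Z -> Rabs (IZR z) <= 1)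
    by (intros z Hz; apply Zabs_Rabs_le, IZR_le, Hz).
  assert (Hz2 : forall z, (Z.abs z <= 1)%Z -> Rabs (IZR z) <= 2 * 1)
    by (intros z Hz'; specialize (Hz z Hz'); lra).
  assert (Hd' : 0 < d <= / 1000) by lra.
  assert (Hu : Rabs (u1 - d * IZR p) <= 40 * 1 * d ^ 2)
    by (apply (tail_expansion d 1 b1 b2 (IZR p) (IZR p') u1 u2 u3); auto; lra).
  assert (Hw : Rabs (w1 - d * IZR q) <= 40 * 1 * d ^ 2)
    by (apply (tail_expansion d 1 x1 x2 (IZR q) (IZR q') w1 w2 w3); auto; lra).
  assert (Hd2 : 0 < d ^ 2 <= d / 1000000) by (apply square_small; exact Hd).
  assert (Hd3 : 0 < d ^ 3 <= d ^ 2 / 1000000) by (apply cube_small; exact Hd).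
  assert (Hbx : 0 <= x * b <= 5 * d ^ 2).
  { apply Rabs_le_between in Hb, Hx.
    split; [apply Rmult_le_pos; lra |].
    apply Rle_trans with ((2 * d) * (2 * d)); [| nra].
    apply Rmult_le_compat; lra. }
  destruct Hcase as [Hts | [Hts HV]].
  - assert (Hsmall : forall v r, Rabs r <= 1 -> Rabs (v - d * r) <= 40 * 1 * d ^ 2 ->
               Rabs v <= / 100).
    { intros v r Hr Hv.
      apply Rabs_le_between in Hv, Hr; apply Rabs_le; split; nra. }
    specialize (Hsmall u1 (IZR p) (Hz p Hp) Hu) as Hu1'.
    specialize (Hsmall w1 (IZR q) (Hz q Hq) Hw) as Hw1'.
    pose proof (Hz t Ht) as Ht'; pose proof (Hz s Hs) as Hs'.
    apply IZR_le in Hts; rewrite plus_IZR in Hts.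
    apply Rabs_le_between in Hu1', Hw1', Ht', Hs', Hb, Hx.
    set (P := 1 - IZR t - u1); set (Q := 1 - IZR s - w1).
    replace (1 - b + b * (IZR t + u1)) with (1 - b * P) by (unfold P; ring).
    replace (1 - x + x * (IZR s + w1)) with (1 - x * Q) by (unfold Q; ring).
    assert (HP : - / 100 <= P <= 201 / 100) by (unfold P; lra).
    assert (HQ : - / 100 <= Q <= 201 / 100) by (unfold Q; lra).
    assert (HPQ : P + Q <= 202 / 100) by (unfold P, Q; lra).
    assert (HbP : Rabs ((b - d) * P) <= 2 * d ^ 2 * (201 / 100))
      by (apply Rabs_mult_le; apply Rabs_le; lra).
    assert (HxQ : Rabs ((x - d) * Q) <= 2 * d ^ 2 * (201 / 100))
      by (apply Rabs_mult_le; apply Rabs_le; lra).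
    assert (HPQ2 : Rabs (x * b * (P * Q)) <= 5 * d ^ 2 * (201 / 100 * (201 / 100))).
    { apply Rabs_mult_le; [rewrite Rabs_pos_eq; lra |].
      apply Rabs_mult_le; apply Rabs_le; lra. }
    apply Rabs_le_between in HbP, HxQ, HPQ2.
    assert (HdPQ : d * (P + Q) <= d * (202 / 100)) by (apply Rmult_le_compat_l; lra).
    replace ((1 - b * P) * (1 - x * Q)) with
      (1 - d * (P + Q) - (b - d) * P - (x - d) * Q + x * b * (P * Q)) by ring.
    apply Rle_trans with (1 - 3 * d + 4 * d ^ 2 - 600 * d ^ 3); [| lra].
    rewrite <- (Rmult_1_r (1 - 3 * d + 4 * d ^ 2 - 600 * d ^ 3)) at 2.
    apply Rmult_le_compat_l; lra.
  - assert (Heps : 0 <= IZR eps <= 1 /\ 0 <= IZR eps' <= 1)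
      by (destruct He as [-> | ->], He' as [-> | ->]; lra).
    assert (E := vertex_expansion d 1 (IZR eps) (IZR eps') b x (IZR t) (IZR s) (IZR p) (IZR q)
                   u1 w1 Hd' ltac:(lra) (proj1 Heps) (proj2 Heps) Hb Hb' Hx Hx' (Hz t Ht) (Hz s Hs)
                   (Hz2 p Hp) (Hz2 q Hq) ltac:(rewrite <- plus_IZR, Hts; reflexivity) Hu Hw).
    apply IZR_le in HV.
    rewrite !plus_IZR, !mult_IZR, !minus_IZR in HV.
    apply Rabs_le_between in E; destruct E as [E _].
    replace (1 - b * (1 - IZR t - u1)) with (1 - b + b * (IZR t + u1)) in E by ring.
    replace (1 - x * (1 - IZR s - w1)) with (1 - x + x * (IZR s + w1)) in E by ring.
    set (V := IZR p + IZR q + IZR eps * (1 - IZR t) + IZR eps' * (1 - IZR s)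
              + (1 - IZR t) * (1 - IZR s)) in *.
    assert (0 <= d ^ 2 * (V - 3)) by (apply Rmult_le_pos; lra).
    assert (600 * d ^ 3 * (x * b) <= 600 * d ^ 3 * / 2) by (apply Rmult_le_compat_l; lra).
    replace ((1 - 3 * d + 4 * d ^ 2 - 600 * d ^ 3) * (1 - x * b)) with
      ((1 - x * b) * (1 - 3 * d + 4 * d ^ 2) - 600 * d ^ 3 + 600 * d ^ 3 * (x * b)) by ring.
    lra.
Qed.

(** This treats the vertices i = j. As 1 + t and 1 - s are nonnegative, each factor is at least 1 -
    10 d^2, with no loss of first order. *)
Lemma far_vertex_lower (d b x t s u1 w1 : R) :
  0 < d <= / 1000000 -> 0 <= b <= 2 * d -> 0 <= x <= 2 * d ->
  Rabs t <= 1 -> Rabs s <= 1 -> Rabs u1 <= 5 * d -> Rabs w1 <= 5 * d ->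
  (1 - 3 * d + 4 * d ^ 2 - 600 * d ^ 3) * (1 - x * b)
    <= (1 + b + b * (t + u1)) * (1 + x - x * (s + w1)).
Proof.
  intros Hd Hb Hx Ht Hs Hu Hw.
  apply Rabs_le_between in Ht, Hs, Hu, Hw.
  assert (Hd2 : 0 < d ^ 2 <= d / 1000000) by (apply square_small; exact Hd).
  assert (Hd3 : 0 < d ^ 3 <= d ^ 2 / 1000000) by (apply cube_small; exact Hd).
  assert (Hxb : 0 <= x * b <= 4 * d ^ 2).
  { split; [apply Rmult_le_pos; lra |].
    replace (4 * d ^ 2) with ((2 * d) * (2 * d)) by ring; apply Rmult_le_compat; lra. }
  assert (H1 : 1 - 10 * d ^ 2 <= 1 + b + b * (t + u1)).
  { assert (b * (- (5 * d)) <= b * (1 + t + u1)) by (apply Rmult_le_compat_l; lra).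
    assert (b * (5 * d) <= 2 * d * (5 * d)) by (apply Rmult_le_compat_r; lra).
    lra. }
  assert (H2 : 1 - 10 * d ^ 2 <= 1 + x - x * (s + w1)).
  { assert (x * (- (5 * d)) <= x * (1 - s - w1)) by (apply Rmult_le_compat_l; lra).
    assert (x * (5 * d) <= 2 * d * (5 * d)) by (apply Rmult_le_compat_r; lra).
    lra. }
  apply Rle_trans with (1 - 3 * d + 4 * d ^ 2 - 600 * d ^ 3).
  { rewrite <- (Rmult_1_r (1 - 3 * d + 4 * d ^ 2 - 600 * d ^ 3)) at 2.
    apply Rmult_le_compat_l; lra. }
  apply Rle_trans with ((1 - 10 * d ^ 2) * (1 - 10 * d ^ 2)).
  { assert (0 <= d ^ 2 * d ^ 2) by (apply Rmult_le_pos; lra). lra. }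
  apply Rmult_le_compat; lra.
Qed.

(** * The chain of levels *)

Definition digit (Rr : Z) (k : nat) : Z := (Rr + block_shift k)%Z.

(* With [q_k] the denominators of the convergents, [back_rem k = q_(k-1) / q_k],
   [conv_den k = q_k] and [conv_err k = |q_(k-1) alpha - p_(k-1)|]. *)
Fixpoint back_rem (Rr : Z) (k : nat) : R :=
  match k with O => 0 | S m => / (IZR (digit Rr m) - back_rem Rr m) end.

Fixpoint conv_den (Rr : Z) (k : nat) : R :=
  match k with O => 1 | S m => conv_den Rr m * (IZR (digit Rr m) - back_rem Rr m) end.

Fixpoint conv_err (alpha : R) (k : nat) : R :=
  match k with O => 1 | S m => conv_err alpha m * ncf_rem alpha m end.

(** Twice the first coordinate of the center, divided by q_k. The starting value 1 makes the odd i
    of level 0 correspond to the integers n = (i + 1) / 2. *)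
Fixpoint back_disp (Rr : Z) (tau : nat -> Z) (k : nat) : R :=
  match k with
  | O => 1
  | S m => back_rem Rr (S m) * (IZR (tau m) + back_disp Rr tau m)
  end.

Section Chain.

Variables (Rr : Z) (alpha : R).
Hypothesis HR : (1000000 <= Rr)%Z.
Hypothesis Hexp : has_expansion Rr alpha.

Local Notation d := (/ IZR Rr).
Local Notation a k := (IZR (digit Rr k)).
Local Notation x := (ncf_rem alpha).
Local Notation b := (back_rem Rr).
Local Notation q := (conv_den Rr).
Local Notation D := (conv_err alpha).

Lemma Rr_large : 1000000 <= IZR Rr.
Proof. exact (IZR_le _ _ HR). Qed.

Lemma inv_Rr_bounds : 0 < d <= / 1000000.
Proof.
  pose proof Rr_large; split; [apply Rinv_0_lt_compat | apply Rinv_le_contravar]; lra.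
Qed.

Lemma Rr_inv : IZR Rr * d = 1.
Proof. pose proof Rr_large; apply Rinv_r; lra. Qed.

Lemma digit_shift (k : nat) :
  a k = IZR Rr + IZR (block_shift k) /\ 0 <= IZR (block_shift k) <= 1.
Proof.
  unfold digit; rewrite plus_IZR; split; [reflexivity |].
  destruct (block_shift_cases k) as [-> | ->]; lra.
Qed.

Lemma ncf_digit_eq (k : nat) : zceil (/ x k) = digit Rr k.
Proof. unfold digit; rewrite <- block_digit; exact (proj2 Hexp k). Qed.

Lemma ncf_rem_succ (k : nat) : x (S k) = a k - / x k.
Proof. simpl; now rewrite ncf_digit_eq. Qed.

Lemma ncf_rem_bounds (k : nat) : 0 < x k < 1.
Proof.
  induction k as [| k IH]; [apply Hexp |].
  assert (Hx : 0 <= x (S k) < 1).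
  { simpl; pose proof (zceil_spec (/ x k)); lra. }
  destruct (Req_dec (x (S k)) 0) as [H0 | H0]; [| lra].
  (* A vanishing remainder would have digit 0, as [/ 0 = 0], whereas every digit is at least
     [Rr]. *)
  pose proof (ncf_digit_eq (S k)) as Hd; rewrite H0, Rinv_0 in Hd.
  rewrite (zceil_unique 0 0) in Hd by lra.
  unfold digit in Hd; destruct (block_shift_cases (S k)); lia.
Qed.

Lemma ncf_rem_digit (k : nat) : x k * (a k - x (S k)) = 1.
Proof.
  rewrite ncf_rem_succ; pose proof (ncf_rem_bounds k); field; lra.
Qed.

Lemma ncf_rem_small (k : nat) : 0 <= x k <= 2 * d.
Proof.
  pose proof (ncf_rem_bounds k); split; [lra |].
  pose proof (ncf_rem_digit k) as E; pose proof (ncf_rem_bounds (S k)).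
  destruct (digit_shift k) as [Ha Hs]; pose proof Rr_large; pose proof Rr_inv.
  apply Rmult_le_reg_r with (IZR Rr / 2); [lra |].
  replace (2 * d * (IZR Rr / 2)) with 1 by (field; lra).
  rewrite <- E; apply Rmult_le_compat_l; lra.
Qed.

Lemma ncf_rem_expansion (k : nat) :
  Rabs (x k - d) <= 2 * d ^ 2 /\ Rabs (x k - d + IZR (block_shift k) * d ^ 2) <= 7 * d ^ 3.
Proof.
  pose proof inv_Rr_bounds; destruct (digit_shift k) as [Ha Hs].
  apply (reciprocal_expansion (IZR Rr) d _ (x (S k)));
    [lra | apply Rr_inv | exact Hs | apply ncf_rem_small | rewrite <- Ha; apply ncf_rem_digit].
Qed.

Lemma back_rem_small (k : nat) : 0 <= b k <= 2 * d.
Proof.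
  pose proof inv_Rr_bounds; pose proof Rr_large.
  induction k as [| k IH]; simpl; [lra |].
  destruct (digit_shift k) as [Ha Hs].
  split; [left; apply Rinv_0_lt_compat; lra |].
  apply Rle_trans with (/ (IZR Rr / 2)); [apply Rinv_le_contravar; lra |].
  right; field; lra.
Qed.

Lemma back_rem_digit (k : nat) : b (S k) * (a k - b k) = 1.
Proof.
  pose proof inv_Rr_bounds; pose proof Rr_large; pose proof (back_rem_small k).
  destruct (digit_shift k) as [Ha Hs]; simpl; apply Rinv_l; lra.
Qed.

Lemma back_rem_expansion (k : nat) :
  Rabs (b (S k) - d) <= 2 * d ^ 2 /\
  Rabs (b (S k) - d + IZR (block_shift k) * d ^ 2) <= 7 * d ^ 3.
Proof.
  pose proof inv_Rr_bounds; destruct (digit_shift k) as [Ha Hs].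
  apply (reciprocal_expansion (IZR Rr) d _ (b k));
    [lra | apply Rr_inv | exact Hs | apply back_rem_small | rewrite <- Ha; apply back_rem_digit].
Qed.

Lemma conv_den_pos (k : nat) : 0 < q k.
Proof.
  induction k as [| k IH]; simpl; [lra |].
  pose proof inv_Rr_bounds; pose proof Rr_large; pose proof (back_rem_small k).
  destruct (digit_shift k) as [Ha Hs]; apply Rmult_lt_0_compat; lra.
Qed.

Lemma conv_den_succ (k : nat) : q (S k) * b (S k) = q k.
Proof. simpl q; rewrite Rmult_assoc, (Rmult_comm (_ - _)), back_rem_digit; ring. Qed.

Lemma conv_err_pos (k : nat) : 0 < D k.
Proof.
  induction k as [| k IH]; simpl; [lra |].
  pose proof (ncf_rem_bounds k); apply Rmult_lt_0_compat; lra.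
Qed.

Lemma conv_err_half (k : nat) : D (S k) <= D k * / 2.
Proof.
  simpl; pose proof (conv_err_pos k); pose proof (ncf_rem_small k); pose proof inv_Rr_bounds.
  apply Rmult_le_compat_l; lra.
Qed.

Lemma conv_err_small (k : nat) : D k <= / (INR k + 1).
Proof.
  induction k as [| k IH]; [simpl; lra |].
  apply Rle_trans with (1 := conv_err_half k).
  pose proof (pos_INR k); rewrite S_INR.
  apply Rle_trans with (/ (INR k + 1) * / 2); [lra |].
  rewrite <- Rinv_mult; apply Rinv_le_contravar; lra.
Qed.

(** The left side is the determinant of the basis (q_k, D_(k+1)), (q_(k-1), D_k), which every change
    of level preserves. *)
Lemma conv_determinant (k : nat) : q k * D k * (1 - x k * b k) = 1.
Proof.
  induction k as [| k IH]; [simpl; ring |].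
  etransitivity; [| exact IH]; simpl q; simpl D.
  transitivity (q k * D k * (x k * (a k - x (S k)) - x k * b k
                 + x k * x (S k) * (1 - b (S k) * (a k - b k)))); [ring |].
  rewrite ncf_rem_digit, back_rem_digit; ring.
Qed.

Lemma rem_product_bounds (k : nat) : 0 <= x k * b k <= / 100.
Proof.
  pose proof inv_Rr_bounds; pose proof (back_rem_small k); pose proof (ncf_rem_small k).
  split; [apply Rmult_le_pos; lra |].
  apply Rle_trans with ((2 * d) * (2 * d)); [apply Rmult_le_compat; lra |].
  apply Rle_trans with (2 * d * / 100); [apply Rmult_le_compat_l; lra | lra].
Qed.

(** * Grid points in the coordinates of a level *)

Section Digits.

Variables (tau : nat -> Z) (w : nat -> R).
Hypothesis Hw : forall k, w k = x k * (IZR (tau k) + w (S k)).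

Local Notation u := (back_disp Rr tau).

(* The point [(n, y)] is [c + (i v + j v') / 2] with [v = (q k, D (S k))],
   [v' = (q k * b k, D k)] and [2 c = (q k * u k, - D k * w k)]. *)
Definition grid_point (k : nat) (i j n : Z) (y : R) : Prop :=
  2 * IZR n = q k * (IZR i + b k * IZR j + u k) /\
  2 * y = D k * (x k * IZR i + IZR j - w k).

(** Change of basis: v_(k-1) = a_k v_k - v_(k+1) turns i v_k + j v_(k-1) into (i + a_k j) v_k - j
    v_(k+1), and moving the center by (tau_k / 2) v_k subtracts tau_k. *)
Lemma grid_point_step (k : nat) (i j n : Z) (y : R) :
  grid_point k i j n y <->
  grid_point (S k) (- j) (i + digit Rr k * j - tau k) n y.
Proof.
  assert (En : q (S k) * (IZR (- j) + b (S k) * IZR (i + digit Rr k * j - tau k) + u (S k))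
               = q k * (IZR i + b k * IZR j + u k)).
  { rewrite minus_IZR, plus_IZR, mult_IZR, opp_IZR; simpl u.
    change (/ (a k - b k)) with (b (S k)).
    transitivity (q (S k) * b (S k) * (IZR i + IZR j * a k + u k) - q (S k) * IZR j); [ring |].
    rewrite conv_den_succ; simpl q; ring. }
  assert (Ey : D (S k) * (x (S k) * IZR (- j) + IZR (i + digit Rr k * j - tau k) - w (S k))
               = D k * (x k * IZR i + IZR j - w k)).
  { rewrite (Hw k), minus_IZR, plus_IZR, mult_IZR, opp_IZR; simpl D.
    transitivity (D k * (x k * IZR i + IZR j * (x k * (a k - x (S k)))
                    - x k * (IZR (tau k) + w (S k)))); [ring |].
    rewrite ncf_rem_digit; ring. }
  unfold grid_point; rewrite En, Ey; reflexivity.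
Qed.

(** The coordinates carry the factors q_k and D_k, whose product is removed by the determinant
    identity. *)
Lemma grid_point_product (k : nat) (i j n : Z) (y : R) :
  grid_point k i j n y ->
  4 * (IZR (Z.abs n) * Rabs y) * (1 - x k * b k) =
  Rabs (IZR i + b k * IZR j + u k) * Rabs (x k * IZR i + IZR j - w k).
Proof.
  intros [Hn Hy].
  pose proof (conv_den_pos k); pose proof (conv_err_pos k).
  assert (E : 4 * (IZR (Z.abs n) * Rabs y) = Rabs (2 * IZR n) * Rabs (2 * y)).
  { rewrite !Rabs_mult, (Rabs_pos_eq 2), abs_IZR by lra; ring. }
  rewrite E, Hn, Hy, !Rabs_mult, (Rabs_pos_eq (q k)), (Rabs_pos_eq (D k)) by lra.
  transitivity ((q k * D k * (1 - x k * b k)) *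
    (Rabs (IZR i + b k * IZR j + u k) * Rabs (x k * IZR i + IZR j - w k))); [ring |].
  rewrite conv_determinant; ring.
Qed.

Hypothesis Hpar : forall k, Z.odd (tau k) = Z.odd (digit Rr k).

Lemma grid_point_parity (i j : Z) (k : nat) :
  Z.odd i = true -> Z.odd j = true ->
  Z.odd (i + digit Rr k * j - tau k) = true.
Proof.
  intros Hi Hj; rewrite Z.odd_sub, Z.odd_add, Z.odd_mul, Hi, Hj, Hpar.
  destruct (Z.odd (digit Rr k)); reflexivity.
Qed.

Variables (gamma : R) (m0 : Z).
Hypothesis Hw0 : w 0%nat = 2 * gamma + 1 - alpha + 2 * IZR m0.

(** The change of level is a bijection on pairs of odd integers, since tau_k has the parity of the
    digit. So every odd pair can be carried back to level 0, where it is visibly a grid point. *)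
Lemma grid_point_exists (k : nat) (i j : Z) :
  Z.odd i = true -> Z.odd j = true ->
  exists n m : Z, grid_point k i j n (IZR n * alpha - gamma - IZR m).
Proof.
  revert i j; induction k as [| k IH]; intros i j Hi Hj.
  - apply Z.odd_spec in Hi, Hj; destruct Hi as [i' ->], Hj as [j' ->].
    exists (i' + 1)%Z, (m0 - j')%Z; split; cbn [conv_den conv_err back_rem back_disp ncf_rem]; rewrite ?Hw0.
    + repeat rewrite ?plus_IZR, ?mult_IZR; ring.
    + repeat rewrite ?minus_IZR, ?plus_IZR, ?mult_IZR; ring.
  - destruct (IH (j + tau k + digit Rr k * i)%Z (- i)%Z) as [n [m H]].
    + rewrite !Z.odd_add, Z.odd_mul, Hi, Hj, Hpar.
      destruct (Z.odd (digit Rr k)); reflexivity.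
    + now rewrite Z.odd_opp.
    + exists n, m; apply grid_point_step in H.
      replace (- - i)%Z with i in H by ring.
      now replace (j + tau k + digit Rr k * i + digit Rr k * - i - tau k)%Z with j in H by ring.
Qed.

End Digits.

(** * Upper bound *)

Definition excess_threshold : R := 1 - 3 * d + 4 * d ^ 2 + 10000 * d ^ 3.

Section UpperBound.

Variables (tau : nat -> Z) (w : nat -> R).
Hypothesis Hw : forall k, w k = x k * (IZR (tau k) + w (S k)).
Hypothesis Hpar : forall k, Z.odd (tau k) = Z.odd (digit Rr k).
Hypothesis Hw1 : forall k, Rabs (w k) <= 1.

Local Notation u := (back_disp Rr tau).

Lemma fwd_disp_digit (k : nat) : w k * (a k - x (S k)) = IZR (tau k) + w (S k).
Proof.
  rewrite (Hw k) at 1.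
  rewrite (Rmult_comm (x k)), Rmult_assoc, ncf_rem_digit; ring.
Qed.

Lemma back_disp_digit (k : nat) : u (S k) * (a k - b k) = IZR (tau k) + u k.
Proof.
  change (u (S k)) with (b (S k) * (IZR (tau k) + u k)).
  rewrite (Rmult_comm (b (S k))), Rmult_assoc, back_rem_digit; ring.
Qed.

Lemma tau_abs_le (k : nat) : Rabs (IZR (tau k)) <= IZR Rr + 2.
Proof.
  replace (IZR (tau k)) with (w k * (a k - x (S k)) - w (S k)) by (rewrite fwd_disp_digit; ring).
  destruct (digit_shift k) as [Ha Hs]; pose proof Rr_large; pose proof (ncf_rem_bounds (S k)).
  assert (H1 : Rabs (w k * (a k - x (S k))) <= 1 * (IZR Rr + 1)).
  { apply Rabs_mult_le; [apply Hw1 | rewrite Rabs_pos_eq; lra]. }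
  unfold Rminus at 1; apply Rle_trans with (1 := Rabs_triang _ _).
  rewrite Rabs_Ropp; pose proof (Hw1 (S k)); lra.
Qed.

(** The bound is stable under the recursion because (1 + 4 d)(R - 2 d) exceeds (R + 2) + (1 + 4
    d). *)
Lemma back_disp_le (k : nat) : Rabs (u k) <= 1 + 4 * d.
Proof.
  pose proof inv_Rr_bounds as Hd; pose proof Rr_large as HR'; pose proof Rr_inv as HRd.
  induction k as [| k IH]; [simpl; rewrite Rabs_R1; lra |].
  destruct (digit_shift k) as [Ha Hs]; pose proof (back_rem_small k).
  apply Rmult_le_reg_r with (a k - b k); [lra |].
  rewrite <- (Rabs_pos_eq (a k - b k)) at 1 by lra.
  rewrite <- Rabs_mult, back_disp_digit.
  apply Rle_trans with (1 := Rabs_triang _ _).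
  pose proof (tau_abs_le k).
  apply Rle_trans with ((1 + 4 * d) * (IZR Rr - 2 * d)); [nra |].
  apply Rmult_le_compat_l; lra.
Qed.

Variable K0 : nat.
Hypothesis Hlarge : forall k, (K0 <= k)%nat ->
  excess_threshold * (1 - x k * b k) <= Rabs ((1 - b k + u k) * (1 - x k + w k)) /\
  excess_threshold * (1 - x k * b k) <= Rabs ((1 - b k - u k) * (1 - x k - w k)).

Lemma threshold_weaken (k : nat) :
  (1 - 3 * d) * (1 - x k * b k) <= excess_threshold * (1 - x k * b k).
Proof.
  pose proof inv_Rr_bounds as Hd; pose proof (rem_product_bounds k).
  pose proof (square_small d Hd); pose proof (cube_small d Hd).
  unfold excess_threshold; apply Rmult_le_compat_r; lra.
Qed.

Lemma disp_sqrt_bound (k : nat) : (K0 <= k)%nat ->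
  Rabs (u k) <= 3 * sqrt d /\ Rabs (w k) <= 3 * sqrt d.
Proof.
  intros Hk; pose proof inv_Rr_bounds as Hd.
  destruct (Hlarge k Hk) as [H1 H2]; pose proof (threshold_weaken k) as Ht.
  destruct (displacement_small d (b k) (x k) (u k) (w k)) as [Hu Hw'];
    try (exact (Rle_trans _ _ _ Ht H1)); try (exact (Rle_trans _ _ _ Ht H2)).
  - lra.
  - apply back_rem_small.
  - apply ncf_rem_small.
  - apply back_disp_le.
  - pose proof (Hw1 k); lra.
  - pose proof (sqrt_lt_R0 d ltac:(lra)); pose proof (sqrt_sqrt d ltac:(lra)) as Hs.
    assert (Hsq : forall v, v ^ 2 <= 8 * d -> Rabs v <= 3 * sqrt d).
    { intros v Hv; rewrite <- (Rabs_pos_eq (3 * sqrt d)) by lra.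
      apply Rsqr_le_abs_0; unfold Rsqr.
      replace (3 * sqrt d * (3 * sqrt d)) with (9 * (sqrt d * sqrt d)) by ring.
      rewrite Hs; lra. }
    split; now apply Hsq.
Qed.

Lemma sqrt_inv_Rr_bounds : 0 < sqrt d <= / 1000.
Proof.
  pose proof inv_Rr_bounds as Hd; split; [apply sqrt_lt_R0; lra |].
  rewrite <- (sqrt_Rsqr (/ 1000)) by lra; apply sqrt_le_1_alt; unfold Rsqr; lra.
Qed.

Lemma large_without_abs (k : nat) : (K0 <= k)%nat ->
  excess_threshold * (1 - x k * b k) <= (1 - b k + u k) * (1 - x k + w k) /\
  excess_threshold * (1 - x k * b k) <= (1 - b k - u k) * (1 - x k - w k).
Proof.
  intros Hk; destruct (Hlarge k Hk) as [H1 H2]; destruct (disp_sqrt_bound k Hk) as [Hu Hw'].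
  pose proof sqrt_inv_Rr_bounds; pose proof inv_Rr_bounds.
  pose proof (back_rem_small k); pose proof (ncf_rem_small k).
  apply Rabs_le_between in Hu, Hw'.
  rewrite Rabs_pos_eq in H1, H2 by (apply Rmult_le_pos; lra); tauto.
Qed.

(** At level k + 1 the displacements u and w are tau_k / R and tau_(k+1) / R up to lower order, so
    the bound on u + w forces the integer tau_k + tau_(k+1) below 2 in absolute value. *)
Lemma tau_sum_abs (k : nat) : (K0 <= k)%nat -> (Z.abs (tau k + tau (S k)) <= 1)%Z.
Proof.
  intros Hk; pose proof inv_Rr_bounds as Hd; pose proof sqrt_inv_Rr_bounds as He.
  pose proof (sqrt_sqrt d ltac:(lra)) as Hs.
  destruct (large_without_abs (S k)) as [H1 H2]; [lia |].
  pose proof (threshold_weaken (S k)) as Ht.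
  destruct (disp_sqrt_bound k) as [Hu0 _]; [lia |].
  destruct (disp_sqrt_bound (S k)) as [Hu1 Hw0]; [lia |].
  destruct (disp_sqrt_bound (S (S k))) as [_ Hw2]; [lia |].
  destruct (digit_shift k) as [Ha Hsh]; destruct (digit_shift (S k)) as [Ha' Hsh'].
  pose proof (back_rem_small k); pose proof (ncf_rem_bounds (S (S k))).
  assert (Hsum : Rabs (u (S k) + w (S k)) <= d * (1 + 20 * sqrt d)).
  { apply (displacement_sum_small d (sqrt d) (b (S k)) (x (S k))); auto; try lra.
    - apply back_rem_expansion.
    - apply ncf_rem_expansion. }
  assert (H2' : Rabs (IZR (tau k) + IZR (tau (S k))) < 2).
  { apply (digit_sum_small (IZR Rr) d (sqrt d) (IZR (block_shift k)) (IZR (block_shift (S k)))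
             (b k) (x (S (S k))) (u (S k)) (u k) (w (S k)) (w (S (S k)))); auto; try lra.
    - apply Rr_inv.
    - rewrite <- Ha; apply back_disp_digit.
    - rewrite <- Ha'; apply fwd_disp_digit. }
  rewrite <- plus_IZR, <- abs_IZR in H2'; apply lt_IZR in H2'; lia.
Qed.

Hypothesis HRodd : Z.odd Rr = true.

Lemma tau_parity (k : nat) : Z.odd (tau k) = negb (Z.odd (block_shift k)).
Proof. rewrite Hpar; unfold digit; rewrite Z.odd_add, HRodd; reflexivity. Qed.

(** Equal digits give tau's of equal parity, hence an even sum of absolute value at most 1. *)
Lemma tau_cancel (k : nat) : (K0 <= k)%nat -> block_shift k = block_shift (S k) ->
  (tau k + tau (S k) = 0)%Z.
Proof.
  intros Hk Hsh; pose proof (tau_sum_abs k Hk) as H.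
  assert (Ho : Z.odd (tau k + tau (S k)) = false).
  { rewrite Z.odd_add, !tau_parity, Hsh; now destruct (Z.odd (block_shift (S k))). }
  assert (tau k + tau (S k) <> 1 /\ tau k + tau (S k) <> -1)%Z
    by (split; intros E; rewrite E in Ho; discriminate).
  lia.
Qed.

(** Since [Rr] is odd, the odd one of t, s sits at the digit [Rr], that is, at shift 0. The offset
    in the indices leaves room for the two digits before the boundary that enter the second-order
    expansion. *)
Lemma tau_boundary (j : nat) : (K0 <= j)%nat ->
  block_shift (S (S j)) <> block_shift (S (S (S j))) ->
  let t := tau (S (S j)) in let s := tau (S (S (S j))) in
  let v := (tau (S j) + tau (S (S (S (S j)))))%Z in
  (block_shift (S (S j)) = 0 -> t = 1 \/ t = -1)%Z /\
  (block_shift (S (S (S j))) = 0 -> s = 1 \/ s = -1)%Z /\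
  (t + s = 1 /\ v <= -1 \/ t + s = -1 /\ 1 <= v)%Z.
Proof.
  intros Hj Hsh t s v; pose proof inv_Rr_bounds as Hd.
  assert (Hts : (Z.abs (t + s) = 1)%Z).
  { assert (Ho : Z.odd (t + s) = true).
    { unfold t, s; rewrite Z.odd_add, !tau_parity.
      destruct (block_shift_cases (S (S j))) as [E | E],
               (block_shift_cases (S (S (S j)))) as [E' | E'];
        rewrite E, E' in *; tauto || reflexivity. }
    assert (H := tau_sum_abs (S (S j)) ltac:(lia)); fold t s in H.
    assert (t + s <> 0)%Z by (intros E; rewrite E in Ho; discriminate).
    lia. }
  assert (Hcase : exists o, Z.odd o = true /\
    (block_shift (S (S j)) = 0 /\ block_shift (S (S (S j))) = 1 /\ o = t \/
     block_shift (S (S j)) = 1 /\ block_shift (S (S (S j))) = 0 /\ o = s)%Z).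
  { destruct (block_shift_cases (S (S j))) as [E | E],
             (block_shift_cases (S (S (S j)))) as [E' | E']; try congruence.
    - exists t; split; [unfold t; rewrite tau_parity, E; reflexivity | auto].
    - exists s; split; [unfold s; rewrite tau_parity, E'; reflexivity | auto]. }
  destruct Hcase as [o [Ho Hcase]].
  destruct (large_without_abs (S (S (S j)))) as [H1 H2]; [lia |].
  assert (Hu1 : forall k, (K0 <= k)%nat -> Rabs (u k) <= 1).
  { intros k Hk; destruct (disp_sqrt_bound k Hk); pose proof sqrt_inv_Rr_bounds; lra. }
  destruct (boundary_digits d (b (S (S (S j)))) (x (S (S (S j))))
      (b (S (S j))) (b (S j)) (x (S (S (S (S j))))) (x (S (S (S (S (S j))))))
      (u (S (S (S j)))) (u (S (S j))) (u (S j)) (u j)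
      (w (S (S (S j)))) (w (S (S (S (S j))))) (w (S (S (S (S (S j))))))
      (w (S (S (S (S (S (S j)))))))
      (block_shift (S (S j))) (block_shift (S (S (S j)))) t s
      (tau (S j)) (tau (S (S (S (S j))))) (tau j) (tau (S (S (S (S (S j)))))) o) as [Ho1 Hv];
    auto; try apply back_rem_expansion; try apply ncf_rem_expansion;
    try apply back_rem_small; try apply ncf_rem_small; try (apply tau_sum_abs; lia).
  - rewrite Z.add_comm; apply tau_sum_abs; lia.
  - rewrite Z.add_comm; apply tau_sum_abs; lia.
  - fold v in Hv; split; [| split].
    1, 2: destruct Hcase as [(E1 & E2 & <-) | (E1 & E2 & <-)]; rewrite ?E1, ?E2; easy.
    assert (Hsum : (t + s = 1 \/ t + s = -1)%Z) by lia.
    destruct Hsum as [E | E]; rewrite E in Hv |- *; lia.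
Qed.

(* Next to the pair of digits [R] the digit of [R+1] is 0 (positions 2 and 10 of the block), while
   going from position 2 to the right the conditions force successively
   (f 4, f 5) = (2, -2) or (-2, 2), then (f 7, f 8) = (0, 0), then f 10 = 2 or -2. *)
Lemma no_digit_sequence : False.
Proof.
  (* Shifting by a multiple of 11 keeps the positions in the block. The successor allows
     [tau_boundary] to be applied one index before the shifted position and still from [K0] on. *)
  set (M := S K0).
  assert (Hs : forall j, block_shift (j + M * 11) = block_shift j)
    by (intros j; unfold block_shift; now rewrite Nat.Div0.mod_add).
  assert (HM : (S K0 <= M * 11)%nat) by (unfold M; lia).
  set (f := fun j => tau (j + M * 11)).
  assert (Hc : forall j, block_shift j = block_shift (S j) -> (f j + f (S j) = 0)%Z).
  { intros j Hj; apply tau_cancel; [lia |].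
    change (S (j + M * 11)) with (S j + M * 11)%nat; now rewrite !Hs. }
  assert (Hb : forall j, block_shift (S j) <> block_shift (S (S j)) ->
     ((block_shift (S j) = 0 -> f (S j) = 1 \/ f (S j) = -1) /\
      (block_shift (S (S j)) = 0 -> f (S (S j)) = 1 \/ f (S (S j)) = -1) /\
      (f (S j) + f (S (S j)) = 1 /\ f j + f (S (S (S j))) <= -1 \/
       f (S j) + f (S (S j)) = -1 /\ 1 <= f j + f (S (S (S j)))))%Z).
  { intros j Hj.
    destruct (j + M * 11)%nat as [| j'] eqn:Ej; [lia |].
    unfold f; change (S (S (S j)) + M * 11)%nat with (S (S (S (j + M * 11)))).
    change (S (S j) + M * 11)%nat with (S (S (j + M * 11))).
    change (S j + M * 11)%nat with (S (j + M * 11)).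
    rewrite <- (Hs (S j)), <- (Hs (S (S j))).
    change (S (S j) + M * 11)%nat with (S (S (j + M * 11))).
    change (S j + M * 11)%nat with (S (j + M * 11)).
    rewrite Ej; apply tau_boundary; [lia |].
    rewrite <- Ej; change (S (j + M * 11)) with (S j + M * 11)%nat.
    change (S (S j + M * 11)) with (S (S j) + M * 11)%nat; now rewrite !Hs. }
  pose proof (Hc 0%nat eq_refl) as C0; pose proof (Hc 4%nat eq_refl) as C4.
  pose proof (Hc 7%nat eq_refl) as C7; pose proof (Hc 11%nat eq_refl) as C11.
  pose proof (Hb 0%nat ltac:(discriminate)) as [O0 [_ B0]]; specialize (O0 eq_refl).
  pose proof (Hb 1%nat ltac:(discriminate)) as [_ [O1 B1]]; specialize (O1 eq_refl).
  pose proof (Hb 2%nat ltac:(discriminate)) as [O2 [_ B2]]; specialize (O2 eq_refl).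
  pose proof (Hb 4%nat ltac:(discriminate)) as [_ [O4 B4]]; specialize (O4 eq_refl).
  pose proof (Hb 5%nat ltac:(discriminate)) as [O5 [_ B5]]; specialize (O5 eq_refl).
  pose proof (Hb 7%nat ltac:(discriminate)) as [_ [O7 B7]]; specialize (O7 eq_refl).
  pose proof (Hb 8%nat ltac:(discriminate)) as [O8 [_ B8]]; specialize (O8 eq_refl).
  pose proof (Hb 9%nat ltac:(discriminate)) as [_ [O9 B9]]; specialize (O9 eq_refl).
  clear Hb Hc; clearbody f.
  assert (F2 : f 2%nat = 0%Z) by (clear - C0 B0 B1 O0 O1; lia).
  assert (F4 : (f 4%nat = 2 \/ f 4%nat = -2)%Z) by (clear - F2 C4 B1 B2 O1 O2; lia).
  assert (F7 : f 7%nat = 0%Z) by (clear - F4 C4 C7 B4 B5 O4 O5; lia).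
  assert (F10 : f 10%nat = 0%Z) by (clear - C11 B8 B9 O8 O9; lia).
  clear - F7 F10 C7 B7 B8 O7 O8; lia.
Qed.

End UpperBound.

(** * Digits of prescribed parity for an arbitrary gamma *)

Definition nearest_same_parity (y : R) (m : Z) : Z :=
  (m + 2 * zfloor ((y - IZR m + 1) / 2))%Z.

Lemma nearest_same_parity_spec (y : R) (m : Z) :
  Z.odd (nearest_same_parity y m) = Z.odd m /\ Rabs (y - IZR (nearest_same_parity y m)) <= 1.
Proof.
  unfold nearest_same_parity; split.
  - rewrite Z.odd_add, Z.odd_mul; now destruct (Z.odd m).
  - rewrite plus_IZR, mult_IZR; pose proof (zfloor_spec ((y - IZR m + 1) / 2)).
    apply Rabs_le; lra.
Qed.

(** Greedy expansion: each digit is the integer nearest to w_k / x_k among those with the parity of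
    a_k, so that the rest stays in [-1, 1]. *)
Fixpoint fwd_disp (w0 : R) (k : nat) : R :=
  match k with
  | O => w0
  | S m => let y := fwd_disp w0 m / x m in y - IZR (nearest_same_parity y (digit Rr m))
  end.

Definition fwd_digit (w0 : R) (k : nat) : Z :=
  nearest_same_parity (fwd_disp w0 k / x k) (digit Rr k).

Lemma fwd_disp_rec (w0 : R) (k : nat) :
  fwd_disp w0 k = x k * (IZR (fwd_digit w0 k) + fwd_disp w0 (S k)).
Proof.
  simpl; fold (fwd_digit w0 k); pose proof (ncf_rem_bounds k); field; lra.
Qed.

Lemma fwd_disp_le (w0 : R) (k : nat) : Rabs w0 <= 1 -> Rabs (fwd_disp w0 k) <= 1.
Proof. intros H; destruct k; [exact H | apply nearest_same_parity_spec]. Qed.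

(** If a whole tail of products exceeded the bound, so would the two vertices of every late level,
    and the digits of gamma would form a sequence excluded by [no_digit_sequence]. *)
Lemma Mag_upper (gamma : R) : Z.odd Rr = true ->
  ~ (exists m n : Z, gamma = IZR m + IZR n * alpha) ->
  Rbar_le (Mag alpha gamma) (Finite (/ 4 * excess_threshold)).
Proof.
  intros Hodd Hg; apply Mag_le; intros N HN.
  destruct (dnint_pos_below alpha gamma (Z.to_nat N) Hg) as [delta [Hdelta Hbelow]].
  destruct (nearest_same_parity_spec (2 * gamma + 1 - alpha) 0) as [Heven Hnear].
  assert (Hm0 : exists m0, Rabs (2 * gamma + 1 - alpha + 2 * IZR m0) <= 1).
  { exists (- zfloor ((2 * gamma + 1 - alpha - IZR 0 + 1) / 2))%Z.
    unfold nearest_same_parity in Hnear.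
    rewrite plus_IZR, mult_IZR in Hnear; rewrite opp_IZR.
    replace (2 * gamma + 1 - alpha + 2 * _) with
      (2 * gamma + 1 - alpha - (0 + 2 * IZR (zfloor ((2 * gamma + 1 - alpha - 0 + 1) / 2))))
      by ring.
    exact Hnear. }
  clear Heven Hnear; destruct Hm0 as [m0 Hm0].
  set (w0 := 2 * gamma + 1 - alpha + 2 * IZR m0) in *.
  pose proof (fun k => fwd_disp_le w0 k Hm0) as Hw1.
  pose proof (fwd_disp_rec w0) as Hw.
  assert (Hpar : forall k, Z.odd (fwd_digit w0 k) = Z.odd (digit Rr k))
    by (intros k; apply nearest_same_parity_spec).
  (* From level K0 on, 2 D_k < delta. A vertex has |y| <= 3 D_k / 2, so its n lies in the tail. *)
  destruct (INR_unbounded (2 / delta)) as [K0 HK0].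
  apply (no_digit_sequence (fwd_digit w0) (fwd_disp w0) Hw Hpar Hw1 K0); [| exact Hodd].
  intros k Hk.
  pose proof (ncf_rem_small k) as Hx; pose proof inv_Rr_bounds as Hd.
  pose proof (rem_product_bounds k) as Hxb.
  assert (HD : 2 * conv_err alpha k < delta).
  { assert (HK : INR K0 <= INR k) by (now apply le_INR).
    assert (Hq : 0 < 2 / delta) by (apply Rdiv_lt_0_compat; lra).
    apply Rle_lt_trans with (2 * / (INR k + 1)); [pose proof (conv_err_small k); lra |].
    apply Rlt_le_trans with (2 * / (2 / delta)); [| right; field; lra].
    apply Rmult_lt_compat_l; [lra |].
    apply Rinv_lt_contravar; [apply Rmult_lt_0_compat; lra | lra]. }
  assert (Hpoint : forall i j, (i = 1 /\ j = -1 \/ i = -1 /\ j = 1)%Z ->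
    excess_threshold * (1 - x k * b k) <=
    Rabs (IZR i + b k * IZR j + back_disp Rr (fwd_digit w0) k) *
    Rabs (x k * IZR i + IZR j - fwd_disp w0 k)).
  { intros i j Hij.
    destruct (grid_point_exists (fwd_digit w0) (fwd_disp w0) Hw Hpar gamma m0 eq_refl k i j)
      as [n [m Hpt]]; [destruct Hij as [[-> ->] | [-> ->]]; reflexivity .. |].
    rewrite <- (grid_point_product _ _ k i j n _ Hpt).
    set (y := IZR n * alpha - gamma - IZR m) in *.
    assert (Hy : Rabs y < delta).
    { destruct Hpt as [_ Hy].
      assert (H3 : Rabs (x k * IZR i + IZR j - fwd_disp w0 k) <= 3).
      { specialize (Hw1 k); apply Rabs_le_between in Hw1; apply Rabs_le.
        destruct Hij as [[-> ->] | [-> ->]]; lra. }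
      assert (H2 : Rabs (2 * y) = conv_err alpha k * Rabs (x k * IZR i + IZR j - fwd_disp w0 k)).
      { rewrite Hy, Rabs_mult, (Rabs_pos_eq (conv_err alpha k)); [reflexivity |].
        left; apply conv_err_pos. }
      rewrite Rabs_mult, (Rabs_pos_eq 2) in H2 by lra.
      pose proof (conv_err_pos k).
      assert (conv_err alpha k * Rabs (x k * IZR i + IZR j - fwd_disp w0 k)
              <= conv_err alpha k * 3) by (apply Rmult_le_compat_l; lra).
      lra. }
    assert (Hdn : dnint (IZR n * alpha - gamma) <= Rabs y) by apply dnint_le.
    assert (HnN : (N <= Z.abs n)%Z).
    { destruct (Z_lt_le_dec (Z.abs n) N) as [Hlt | Hge]; [| exact Hge].
      specialize (Hbelow n ltac:(lia)); lra. }
    specialize (HN n HnN).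
    assert (Hn0 : 0 <= IZR (Z.abs n)) by (apply IZR_le; lia).
    assert (IZR (Z.abs n) * dnint (IZR n * alpha - gamma) <= IZR (Z.abs n) * Rabs y)
      by (apply Rmult_le_compat_l; lra).
    apply Rmult_le_compat_r; lra. }
  split.
  - assert (H1 := Hpoint 1%Z (-1)%Z ltac:(auto)); rewrite <- Rabs_mult in H1.
    rewrite <- Rabs_Ropp in H1; eapply Rle_trans; [exact H1 | right; f_equal; ring].
  - assert (H1 := Hpoint (-1)%Z 1%Z ltac:(auto)); rewrite <- Rabs_mult in H1.
    rewrite <- Rabs_Ropp in H1; eapply Rle_trans; [exact H1 | right; f_equal; ring].
Qed.

(** * Lower bound *)

(** Zero at each digit R+1 and 1 or -1 at each digit R, as parity demands; the signs are chosen to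
    satisfy [sign_condition] at every level. *)
Definition witness_digit (k : nat) : Z :=
  nth (k mod 11) (-1 :: 1 :: 0 :: -1 :: 0 :: 0 :: -1 :: 0 :: 0 :: 1 :: 0 :: nil)%Z 0%Z.

Lemma mod11_window (P : nat -> nat -> nat -> nat -> Prop) :
  (forall r, (r < 11)%nat ->
     P r (S r mod 11)%nat (S (S r) mod 11)%nat (S (S (S r)) mod 11)%nat) ->
  forall k, P (k mod 11)%nat (S k mod 11)%nat (S (S k) mod 11)%nat (S (S (S k)) mod 11)%nat.
Proof.
  intros H k.
  assert (Hr : (k mod 11 < 11)%nat) by (apply Nat.mod_upper_bound; lia).
  specialize (H _ Hr).
  change (S (k mod 11)) with (1 + k mod 11)%nat in H.
  change (S (1 + k mod 11)) with (2 + k mod 11)%nat in H.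
  change (S (2 + k mod 11)) with (3 + k mod 11)%nat in H.
  now rewrite !Nat.Div0.add_mod_idemp_r in H.
Qed.

(* The second alternative says that the coefficient of [d ^ 2] in [vertex_expansion] is
   nonnegative. *)
Definition sign_condition (eps eps' t s p q : Z) : Prop :=
  (0 <= t + s \/
   t + s = -1 /\ 3 <= p + q + eps * (1 - t) + eps' * (1 - s) + (1 - t) * (1 - s))%Z.

(** The two signs serve the two vertices i = -j of one level. By periodicity only 11 windows of four
    digits need checking. *)
Lemma witness_digit_conditions (k : nat) :
  let p := witness_digit k in let t := witness_digit (S k) in
  let s := witness_digit (S (S k)) in let r := witness_digit (S (S (S k))) in
  let eps := block_shift (S k) in let eps' := block_shift (S (S k)) in
  sign_condition eps eps' t s p r /\ sign_condition eps eps' (- t) (- s) (- p) (- r).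
Proof.
  unfold witness_digit, block_shift; cbv zeta; set (l := (-1 :: _)%Z); set (e := (0 :: _)%Z).
  apply (mod11_window (fun i0 i1 i2 i3 =>
    sign_condition (nth i1 e 0) (nth i2 e 0) (nth i1 l 0) (nth i2 l 0) (nth i0 l 0) (nth i3 l 0) /\
    sign_condition (nth i1 e 0) (nth i2 e 0) (- nth i1 l 0) (- nth i2 l 0) (- nth i0 l 0)
      (- nth i3 l 0))%Z).
  intros r Hr; unfold sign_condition.
  do 11 (destruct r as [| r]; [simpl; lia |]); lia.
Qed.

Lemma witness_digit_small (k : nat) : (Z.abs (witness_digit k) <= 1)%Z.
Proof.
  unfold witness_digit; set (l := (-1 :: _)%Z).
  apply (mod11_cases (fun m => Z.abs (nth m l 0) <= 1)%Z); simpl; lia.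
Qed.

Lemma witness_digit_abs (k : nat) : Rabs (IZR (witness_digit k)) <= 1.
Proof. apply Zabs_Rabs_le, IZR_le, witness_digit_small. Qed.

Lemma witness_digit_parity (k : nat) : Z.odd Rr = true ->
  Z.odd (witness_digit k) = Z.odd (digit Rr k).
Proof.
  intros Hodd; unfold digit; rewrite Z.odd_add, Hodd.
  unfold witness_digit, block_shift; set (l := (-1 :: _)%Z); set (e := (0 :: _)%Z).
  apply (mod11_cases (fun m => Z.odd (nth m l 0) = xorb true (Z.odd (nth m e 0)))%Z);
    reflexivity.
Qed.

(** * The forward displacements of the witness as convergent series *)

Definition witness_term (k j : nat) : R :=
  IZR (witness_digit (k + j)) * conv_err alpha (S (k + j)).

Lemma conv_err_geometric (k j : nat) : D (k + j) <= D k * (/ 2) ^ j.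
Proof.
  induction j as [| j IH]; [rewrite Nat.add_0_r; simpl; lra |].
  rewrite Nat.add_succ_r; apply Rle_trans with (1 := conv_err_half _); simpl; lra.
Qed.

Lemma witness_term_le (k j : nat) : Rabs (witness_term k j) <= D k * / 2 * (/ 2) ^ j.
Proof.
  unfold witness_term; pose proof (conv_err_pos (S (k + j))).
  pose proof (conv_err_half (k + j)); pose proof (conv_err_geometric k j).
  rewrite Rabs_mult, (Rabs_pos_eq (D (S (k + j)))) by lra.
  apply Rle_trans with (1 * D (S (k + j))); [| lra].
  apply Rmult_le_compat_r; [lra | apply witness_digit_abs].
Qed.

Lemma is_series_half (c : R) : is_series (fun j => c * / 2 * (/ 2) ^ j) c.
Proof.
  assert (Hg := is_series_geom (/ 2) ltac:(rewrite Rabs_pos_eq; lra)).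
  apply (is_series_scal (c * / 2)) in Hg.
  refine (eq_ind _ (fun l => is_series (fun j => c * / 2 * (/ 2) ^ j) l) Hg c _).
  unfold scal; simpl; unfold mult; simpl; field.
Qed.

Lemma ex_series_witness_abs (k : nat) : ex_series (fun j => Rabs (witness_term k j)).
Proof.
  apply (ex_series_le (K := R_AbsRing) (V := R_CompleteNormedModule) _ (fun j => D k * / 2 * (/ 2) ^ j)).
  - intros j; unfold norm; simpl; unfold abs; simpl; rewrite Rabs_Rabsolu.
    apply witness_term_le.
  - exists (D k); apply is_series_half.
Qed.

(** Solving w_k = x_k (tau_k + w_(k+1)) forward, with D_(k+1) = D_k x_k, gives D_k w_k as the sum of
    tau_(k+j) D_(k+j+1). *)
Definition witness_disp (k : nat) : R := Series (witness_term k) / conv_err alpha k.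

Lemma witness_disp_rec (k : nat) :
  witness_disp k = x k * (IZR (witness_digit k) + witness_disp (S k)).
Proof.
  unfold witness_disp; rewrite Series_incr_1 by (apply ex_series_Rabs, ex_series_witness_abs).
  rewrite (Series_ext (fun j => witness_term k (S j)) (witness_term (S k))).
  2: { intros j; unfold witness_term; now rewrite Nat.add_succ_r. }
  unfold witness_term at 1; rewrite Nat.add_0_r; simpl D.
  pose proof (conv_err_pos k); pose proof (ncf_rem_bounds k); field; lra.
Qed.

Lemma witness_disp_le_1 (k : nat) : Rabs (witness_disp k) <= 1.
Proof.
  pose proof (conv_err_pos k); unfold witness_disp, Rdiv.
  rewrite Rabs_mult, (Rabs_pos_eq (/ D k)) by (left; now apply Rinv_0_lt_compat).
  apply Rmult_le_reg_r with (D k); [lra |].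
  rewrite Rmult_assoc, Rinv_l, Rmult_1_r, Rmult_1_l by lra.
  apply Rle_trans with (1 := Series_Rabs _ (ex_series_witness_abs k)).
  rewrite <- (is_series_unique _ _ (is_series_half (D k))).
  apply Series_le; [| exists (D k); apply is_series_half].
  intros j; split; [apply Rabs_pos | apply witness_term_le].
Qed.

Lemma witness_disp_le (k : nat) : Rabs (witness_disp k) <= 4 * d.
Proof.
  rewrite witness_disp_rec; replace (4 * d) with ((2 * d) * 2) by ring.
  pose proof (ncf_rem_small k).
  apply Rabs_mult_le; [rewrite Rabs_pos_eq; lra |].
  apply Rle_trans with (1 := Rabs_triang _ _).
  pose proof (witness_digit_abs k); pose proof (witness_disp_le_1 (S k)); lra.
Qed.

Local Notation tau := witness_digit.
Local Notation w := witness_disp.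
Local Notation u := (back_disp Rr witness_digit).

Lemma witness_back_le_1 (k : nat) : Rabs (u k) <= 1 /\ Rabs (u (S k)) <= 4 * d.
Proof.
  pose proof inv_Rr_bounds as Hd.
  assert (Hstep : forall m, Rabs (u m) <= 1 -> Rabs (u (S m)) <= 4 * d).
  { intros m Hm; change (u (S m)) with (b (S m) * (IZR (tau m) + u m)).
    replace (4 * d) with ((2 * d) * 2) by ring.
    pose proof (back_rem_small (S m)).
    apply Rabs_mult_le; [rewrite Rabs_pos_eq; lra |].
    apply Rle_trans with (1 := Rabs_triang _ _).
    pose proof (witness_digit_abs m); lra. }
  induction k as [| k [IH1 IH2]].
  - assert (Rabs (u 0) <= 1) by (simpl; rewrite Rabs_R1; lra); auto.
  - assert (Rabs (u (S k)) <= 1) by lra; auto.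
Qed.

Definition deficit_threshold : R := 1 - 3 * d + 4 * d ^ 2 - 600 * d ^ 3.

(** The pairs with i = -i' are the near vertices, where the sign condition is needed; those with i =
    i' are the far ones. Level 3 is the first with enough digits behind it for the second-order
    expansion. *)
Lemma witness_vertex (j : nat) (i i' : Z) :
  (Z.abs i = 1)%Z -> (Z.abs i' = 1)%Z ->
  let k := S (S (S j)) in
  deficit_threshold * (1 - x k * b k)
    <= Rabs (IZR i + b k * IZR i' + u k) * Rabs (x k * IZR i + IZR i' - w k).
Proof.
  intros Hi Hi' k; pose proof inv_Rr_bounds as Hd.
  destruct (witness_digit_conditions (S j)) as [C1 C2].
  assert (Hu : u k = b k * (IZR (tau (S (S j))) + u (S (S j)))) by reflexivity.
  assert (Hwk : w k = x k * (IZR (tau k) + w (S k))) by apply witness_disp_rec.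
  assert (Hu3 : Rabs (u j) <= 1) by apply witness_back_le_1.
  assert (N1 : deficit_threshold * (1 - x k * b k) <= (1 - b k + u k) * (1 - x k + w k)).
  { rewrite Hu, Hwk.
    apply (near_vertex_lower d (b k) (x k) (b (S (S j))) (b (S j)) (x (S k)) (x (S (S k)))
      (u (S (S j))) (u (S j)) (u j) (w (S k)) (w (S (S k))) (w (S (S (S k))))
      (block_shift (S (S j))) (block_shift k) (tau (S (S j))) (tau k)
      (tau (S j)) (tau (S k)) (tau j) (tau (S (S k)))); auto;
      try apply block_shift_cases; try apply back_rem_expansion; try apply ncf_rem_expansion;
      try apply back_rem_small; try apply ncf_rem_small; try apply witness_disp_rec;
      try apply witness_digit_small; try apply witness_disp_le_1. }
  assert (N2 : deficit_threshold * (1 - x k * b k) <= (1 - b k - u k) * (1 - x k - w k)).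
  { replace (1 - b k - u k) with (1 - b k + b k * (IZR (- tau (S (S j))) + - u (S (S j))))
      by (rewrite Hu, opp_IZR; ring).
    replace (1 - x k - w k) with (1 - x k + x k * (IZR (- tau k) + - w (S k)))
      by (rewrite Hwk, opp_IZR; ring).
    apply (near_vertex_lower d (b k) (x k) (b (S (S j))) (b (S j)) (x (S k)) (x (S (S k)))
      (- u (S (S j))) (- u (S j)) (- u j) (- w (S k)) (- w (S (S k))) (- w (S (S (S k))))
      (block_shift (S (S j))) (block_shift k) (- tau (S (S j))) (- tau k)
      (- tau (S j)) (- tau (S k)) (- tau j) (- tau (S (S k))));
      rewrite ?Rabs_Ropp, ?Z.abs_opp; auto;
      try apply block_shift_cases; try apply back_rem_expansion; try apply ncf_rem_expansion;
      try apply back_rem_small; try apply ncf_rem_small;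
      try apply witness_digit_small; try apply witness_disp_le_1; rewrite opp_IZR.
    - change (u (S (S j))) with (b (S (S j)) * (IZR (tau (S j)) + u (S j))); ring.
    - change (u (S j)) with (b (S j) * (IZR (tau j) + u j)); ring.
    - rewrite (witness_disp_rec (S k)); ring.
    - rewrite (witness_disp_rec (S (S k))); ring. }
  assert (Hfar : forall t s u1 w1, Rabs t <= 1 -> Rabs s <= 1 -> Rabs u1 <= 5 * d ->
            Rabs w1 <= 5 * d -> deficit_threshold * (1 - x k * b k)
              <= (1 + b k + b k * (t + u1)) * (1 + x k - x k * (s + w1)))
    by (intros; apply far_vertex_lower; auto using back_rem_small, ncf_rem_small).
  assert (Hu2 : Rabs (u (S (S j))) <= 5 * d)
    by (pose proof (proj2 (witness_back_le_1 (S j))); lra).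
  assert (Hw2 : Rabs (w (S k)) <= 5 * d) by (pose proof (witness_disp_le (S k)); lra).
  assert (F1 : deficit_threshold * (1 - x k * b k) <= (1 + b k + u k) * (1 + x k - w k)).
  { rewrite Hu, Hwk; apply Hfar; auto; apply witness_digit_abs. }
  assert (F2 : deficit_threshold * (1 - x k * b k) <= (1 + b k - u k) * (1 + x k + w k)).
  { replace (1 + b k - u k) with (1 + b k + b k * (- IZR (tau (S (S j))) + - u (S (S j))))
      by (rewrite Hu; ring).
    replace (1 + x k + w k) with (1 + x k - x k * (- IZR (tau k) + - w (S k)))
      by (rewrite Hwk; ring).
    apply Hfar; rewrite ?Rabs_Ropp; auto; apply witness_digit_abs. }
  rewrite <- Rabs_mult.
  assert (Hsign : forall m, (Z.abs m = 1)%Z -> (m = 1 \/ m = -1)%Z) by (intros; lia).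
  clearbody k.
  destruct (Hsign i Hi) as [-> | ->], (Hsign i' Hi') as [-> | ->].
  - eapply Rle_trans; [exact F1 |].
    eapply Rle_trans; [apply Rle_abs | right; f_equal; ring].
  - eapply Rle_trans; [exact N1 |].
    eapply Rle_trans; [apply Rle_abs | rewrite <- Rabs_Ropp; right; f_equal; ring].
  - eapply Rle_trans; [exact N2 |].
    eapply Rle_trans; [apply Rle_abs | rewrite <- Rabs_Ropp; right; f_equal; ring].
  - eapply Rle_trans; [exact F2 |].
    eapply Rle_trans; [apply Rle_abs | right; f_equal; ring].
Qed.

(** Solution of w_0 = 2 gamma + 1 - alpha, which places the grid at level 0. *)
Definition witness_gamma : R := (w 0%nat - 1 + alpha) / 2.

(** The coordinates (i, j) of one fixed grid point at all levels. As the next i is -j, the sequence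
    of first coordinates determines both. *)
Fixpoint grid_coords (n m : Z) (k : nat) : Z * Z :=
  match k with
  | O => (2 * n - 1, 1 - 2 * m)%Z
  | S l => let c := grid_coords n m l in (- snd c, fst c + digit Rr l * snd c - tau l)%Z
  end.

Lemma grid_coords_spec (n m : Z) (k : nat) : Z.odd Rr = true ->
  let i l := fst (grid_coords n m l) in
  Z.odd (i k) = true /\
  grid_point tau w k (i k) (- i (S k)) n (IZR n * alpha - witness_gamma - IZR m).
Proof.
  intros Hodd i.
  assert (H : forall l, Z.odd (fst (grid_coords n m l)) = true /\
      Z.odd (snd (grid_coords n m l)) = true /\
      grid_point tau w l (fst (grid_coords n m l)) (snd (grid_coords n m l)) n
        (IZR n * alpha - witness_gamma - IZR m)).
  { induction l as [| l [IH1 [IH2 IH3]]].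
    - split; [| split].
      + cbn [grid_coords fst]; rewrite Z.odd_sub, Z.odd_mul; reflexivity.
      + cbn [grid_coords snd]; rewrite Z.odd_sub, Z.odd_mul; reflexivity.
      + split; cbn [grid_coords fst snd conv_den conv_err back_rem back_disp ncf_rem];
          repeat rewrite ?minus_IZR, ?mult_IZR; unfold witness_gamma; field.
    - cbn [grid_coords fst snd]; split; [| split].
      + now rewrite Z.odd_opp.
      + apply grid_point_parity; auto; intros; now apply witness_digit_parity.
      + apply (proj1 (grid_point_step tau w witness_disp_rec l _ _ n _)), IH3. }
  destruct (H k) as [H1 [_ H3]]; split; [exact H1 |].
  unfold i; cbn [grid_coords fst]; now rewrite Z.opp_involutive.
Qed.

(** * Descent to the level of least first coordinate *)

Lemma exists_min_from (f : nat -> nat) (k0 : nat) :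
  exists k, (k0 <= k)%nat /\ forall l, (k0 <= l)%nat -> (f k <= f l)%nat.
Proof.
  assert (H : forall v k, f k = v -> (k0 <= k)%nat ->
            exists k, (k0 <= k)%nat /\ forall l, (k0 <= l)%nat -> (f k <= f l)%nat).
  { induction v as [v IH] using lt_wf_ind; intros k Hv Hk.
    destruct (Classical_Prop.classic (exists l, (k0 <= l)%nat /\ (f l < f k)%nat))
      as [[l [Hl Hlt]] | Hno].
    - apply (IH (f l)) with l; auto; lia.
    - exists k; split; [exact Hk |]; intros l Hl.
      destruct (le_lt_dec (f k) (f l)); [easy | exfalso; eauto]. }
  now apply (H (f k0) k0).
Qed.

Lemma second_factor_lower (k : nat) (i j : Z) :
  (1 <= Z.abs j)%Z -> (Z.abs i <= Z.abs j)%Z ->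
  IZR (Z.abs j) * (99 / 100) <= Rabs (x k * IZR i + IZR j - w k).
Proof.
  intros Hj Hij; pose proof inv_Rr_bounds as Hd.
  apply IZR_le in Hj, Hij; rewrite !abs_IZR in *.
  pose proof (witness_disp_le k); pose proof (ncf_rem_small k).
  assert (Hxi : Rabs (x k * IZR i) <= (2 * d) * Rabs (IZR j))
    by (apply Rabs_mult_le; [rewrite Rabs_pos_eq; lra | exact Hij]).
  assert (Htri : Rabs (IZR j) <= Rabs (x k * IZR i + IZR j - w k) + Rabs (x k * IZR i) + Rabs (w k)).
  { replace (IZR j) with ((x k * IZR i + IZR j - w k) + (- (x k * IZR i) + w k)) at 1 by ring.
    apply Rle_trans with (1 := Rabs_triang _ _).
    pose proof (Rabs_triang (- (x k * IZR i)) (w k)); rewrite Rabs_Ropp in *; lra. }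
  assert (2 * d * Rabs (IZR j) <= / 1000 * Rabs (IZR j)) by (apply Rmult_le_compat_r; lra).
  lra.
Qed.

Lemma first_factor_lower (k : nat) (i j : Z) :
  (1 <= Z.abs i)%Z ->
  Rabs (IZR i) - b (S k) * Rabs (IZR j) - 4 * d <= Rabs (IZR i + b (S k) * IZR j + u (S k)).
Proof.
  intros Hi; pose proof (proj2 (witness_back_le_1 k)) as Hu.
  pose proof (back_rem_small (S k)).
  assert (E : Rabs (b (S k) * IZR j) = b (S k) * Rabs (IZR j))
    by (rewrite Rabs_mult, (Rabs_pos_eq (b (S k))); lra).
  rewrite <- E.
  assert (Htri : Rabs (IZR i) <=
     Rabs (IZR i + b (S k) * IZR j + u (S k)) + Rabs (b (S k) * IZR j) + Rabs (u (S k))).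
  { replace (IZR i) with ((IZR i + b (S k) * IZR j + u (S k)) +
      - (b (S k) * IZR j + u (S k))) at 1 by ring.
    apply Rle_trans with (1 := Rabs_triang _ _); rewrite Rabs_Ropp.
    pose proof (Rabs_triang (b (S k) * IZR j) (u (S k))); lra. }
  lra.
Qed.

Lemma deficit_threshold_le (k : nat) : deficit_threshold * (1 - x k * b k) <= 1.
Proof.
  pose proof inv_Rr_bounds as Hd; pose proof (rem_product_bounds k).
  pose proof (square_small d Hd); pose proof (cube_small d Hd).
  apply Rle_trans with (1 * 1); [| lra].
  unfold deficit_threshold; apply Rmult_le_compat; lra.
Qed.

Lemma odd_abs_cases (i : Z) : Z.odd i = true -> (Z.abs i = 1 \/ 3 <= Z.abs i)%Z.
Proof. intros H; apply Z.odd_spec in H; destruct H as [m ->]; lia. Qed.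

(* Among the levels from 3 on, take one where the first odd coordinate [i] is least in absolute
   value: there the point is a vertex of its level or of the preceding one, or far out. *)
Lemma witness_lower (n m : Z) : Z.odd Rr = true ->
  let y := IZR n * alpha - witness_gamma - IZR m in
  y <> 0 /\ (q 3 <= IZR (Z.abs n) -> / 4 * deficit_threshold <= IZR (Z.abs n) * Rabs y).
Proof.
  intros Hodd y; pose proof inv_Rr_bounds as Hd; pose proof Rr_inv as HRd.
  pose proof Rr_large as HRl.
  set (i := fun l => fst (grid_coords n m l)).
  assert (Hi : forall l, (Z.abs (i l) = 1 \/ 3 <= Z.abs (i l))%Z)
    by (intros l; apply odd_abs_cases, (grid_coords_spec n m l Hodd)).
  assert (Hp : forall l, grid_point tau w l (i l) (- i (S l)) n y)
    by (intros l; apply (grid_coords_spec n m l Hodd)).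
  destruct (exists_min_from (fun l => Z.to_nat (Z.abs (i l))) 3) as [k [Hk Hmin]].
  assert (Hmin' : forall l, (3 <= l)%nat -> (Z.abs (i k) <= Z.abs (i l))%Z)
    by (intros l Hl; specialize (Hmin l Hl); lia).
  clear Hmin.
  assert (HY : IZR (Z.abs (- i (S k))) * (99 / 100)
               <= Rabs (x k * IZR (i k) + IZR (- i (S k)) - w k)).
  { apply second_factor_lower; rewrite Z.abs_opp; [destruct (Hi (S k)); lia |].
    apply Hmin'; lia. }
  assert (HY1 : 99 / 100 <= Rabs (x k * IZR (i k) + IZR (- i (S k)) - w k)).
  { assert (1 <= IZR (Z.abs (- i (S k)))) by (apply IZR_le; destruct (Hi (S k)); lia). lra. }
  assert (Hred : forall l, deficit_threshold * (1 - x l * b l) <=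
      Rabs (IZR (i l) + b l * IZR (- i (S l)) + u l) *
      Rabs (x l * IZR (i l) + IZR (- i (S l)) - w l) ->
      / 4 * deficit_threshold <= IZR (Z.abs n) * Rabs y).
  { intros l Hl; rewrite <- (grid_point_product tau w l _ _ n y (Hp l)) in Hl.
    pose proof (rem_product_bounds l); apply Rmult_le_reg_r in Hl; lra. }
  assert (Hvert : forall l, (3 <= l)%nat -> (Z.abs (i l) = 1)%Z -> (Z.abs (i (S l)) = 1)%Z ->
            / 4 * deficit_threshold <= IZR (Z.abs n) * Rabs y).
  { intros l Hl H1 H2; apply (Hred l).
    destruct l as [| [| [| l]]]; try lia.
    apply witness_vertex; [exact H1 | now rewrite Z.abs_opp]. }
  assert (Hfar : 1 <= Rabs (IZR (i k) + b k * IZR (- i (S k)) + u k) *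
                      Rabs (x k * IZR (i k) + IZR (- i (S k)) - w k) ->
            / 4 * deficit_threshold <= IZR (Z.abs n) * Rabs y).
  { intros H; apply (Hred k); pose proof (deficit_threshold_le k); lra. }
  split.
  (* At the minimal level the second factor is at least 99/100, so y cannot vanish. *)
  { intros Hy0; destruct (Hp k) as [_ HYk]; rewrite Hy0, Rmult_0_r in HYk.
    symmetry in HYk; apply Rmult_integral in HYk; pose proof (conv_err_pos k).
    destruct HYk as [H0 | H0]; [lra |]; rewrite H0, Rabs_R0 in HY1; lra. }
  intros Hn.
  destruct (Hi (S k)) as [Hj | Hj].
  { assert (Hik := Hmin' (S k) ltac:(lia)).
    apply (Hvert k Hk); [destruct (Hi k) |]; lia. }
  assert (Hj3 : 3 <= IZR (Z.abs (- i (S k)))) by (apply IZR_le; lia).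
  (* At level 3 there is no earlier level to compare with; instead |n| >= q_3 makes the first factor
     at least 2. *)
  destruct (Nat.eq_dec k 3) as [-> | Hk3].
  { apply Hfar; destruct (Hp 3%nat) as [HX _]; pose proof (conv_den_pos 3) as Hq.
    apply (f_equal Rabs) in HX.
    rewrite !Rabs_mult, (Rabs_pos_eq 2), (Rabs_pos_eq (q 3)), <- abs_IZR in HX by lra.
    assert (2 <= Rabs (IZR (i 3%nat) + b 3 * IZR (- i 4%nat) + u 3)).
    { apply Rmult_le_reg_l with (q 3); lra. }
    apply Rle_trans with (2 * (99 / 100)); [lra | apply Rmult_le_compat; lra]. }
  destruct k as [| k]; [lia |].
  destruct (Hi k) as [Hprev | Hprev].
  { apply (Hvert k); [lia | exact Hprev |].
    assert (H := Hmin' k ltac:(lia)); destruct (Hi (S k)); lia. }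
  apply Hfar.
  destruct (back_rem_expansion k) as [Hb _]; apply Rabs_le_between in Hb.
  assert (Hd2 : 0 < d ^ 2 <= d / 1000000) by (apply square_small; exact Hd).
  (* Both neighbors of the least coordinate are now at least 3 in absolute value. If |j| <= R/2,
     then b |j| takes away little more than 1/2 from the first factor, and the second is at least 3
     times 99/100. *)
  destruct (Rle_or_lt (IZR (Z.abs (- i (S (S k))))) (IZR Rr / 2)) as [Hsmall | Hbig].
  - assert (HX : 48 / 100 <= Rabs (IZR (i (S k)) + b (S k) * IZR (- i (S (S k))) + u (S k))).
    { assert (H1 : (1 <= Z.abs (i (S k)))%Z) by (destruct (Hi (S k)); lia).
      eapply Rle_trans; [| apply first_factor_lower; exact H1].
      apply IZR_le in H1; rewrite abs_IZR in H1, Hsmall.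
      assert (b (S k) * Rabs (IZR (- i (S (S k)))) <= 101 / 100 * d * (IZR Rr / 2))
        by (apply Rmult_le_compat; lra || apply Rabs_pos).
      lra. }
    apply Rle_trans with (48 / 100 * (3 * (99 / 100))); [lra | apply Rmult_le_compat; lra].
  (* If |j| > R/2, the first factor may cancel, so it is read off the preceding level: there it is
     at least 29/10, and equality of both expressions for 2 n scales it by b_(k+1), about 1/R. The
     second factor exceeds 99/100 times R/2 and compensates. *)
  - assert (HX : 99 / 100 * d * (29 / 10)
              <= Rabs (IZR (i (S k)) + b (S k) * IZR (- i (S (S k))) + u (S k))).
    { assert (E : IZR (i (S k)) + b (S k) * IZR (- i (S (S k))) + u (S k) =
                  b (S k) * (IZR (i k) + b k * IZR (- i (S k)) + u k)).
      { pose proof (conv_den_pos (S k)).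
        apply Rmult_eq_reg_l with (q (S k)); [| lra].
        rewrite <- Rmult_assoc, conv_den_succ.
        rewrite <- (proj1 (Hp k)); symmetry; apply (Hp (S k)). }
      rewrite E, Rabs_mult, (Rabs_pos_eq (b (S k))) by lra.
      apply Rmult_le_compat; try lra.
      destruct k as [| k]; [lia |].
      eapply Rle_trans; [| apply first_factor_lower; lia].
      assert (Hik := Hmin' (S k) ltac:(lia)).
      rewrite opp_IZR, Rabs_Ropp, <- !abs_IZR.
      apply IZR_le in Hprev, Hik; pose proof (back_rem_small (S k)).
      assert (b (S k) * IZR (Z.abs (i (S (S k)))) <= / 1000 * IZR (Z.abs (i (S k)))).
      { apply Rmult_le_compat; try lra; apply IZR_le; lia. }
      lra. }
    apply Rle_trans with (99 / 100 * d * (29 / 10) * (IZR Rr / 2 * (99 / 100))); [lra |].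
    apply Rmult_le_compat; lra.
Qed.

Lemma Mag_witness_gamma : Z.odd Rr = true ->
  Rbar_le (Finite (/ 4 * deficit_threshold)) (Mag alpha witness_gamma).
Proof.
  intros Hodd; apply Mag_ge with (zceil (q 3)); intros n Hn.
  destruct (dnint_attained (IZR n * alpha - witness_gamma)) as [m ->].
  apply witness_lower; [exact Hodd |].
  apply IZR_le in Hn; destruct (zceil_spec (q 3)); lra.
Qed.

(** A representation of gamma in the lattice would be a grid point with y = 0. *)
Lemma witness_gamma_not_lattice : Z.odd Rr = true ->
  ~ (exists m n : Z, witness_gamma = IZR m + IZR n * alpha).
Proof.
  intros Hodd [m [n E]].
  apply (proj1 (witness_lower n (- m) Hodd)); rewrite E, opp_IZR; ring.
Qed.

Lemma rho_bounds : Z.odd Rr = true ->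
  exists r, rho alpha = Finite r /\
    / 4 * deficit_threshold <= r <= / 4 * excess_threshold.
Proof.
  intros Hodd.
  assert (Hup : Rbar_le (rho alpha) (Finite (/ 4 * excess_threshold))).
  { apply (proj2 (Rbar_lub_spec _)); intros y [gamma [Hg ->]]; now apply Mag_upper. }
  assert (Hlo : Rbar_le (Finite (/ 4 * deficit_threshold)) (rho alpha)).
  { apply Rbar_le_trans with (1 := Mag_witness_gamma Hodd).
    apply (proj1 (Rbar_lub_spec _)); exists witness_gamma.
    split; [now apply witness_gamma_not_lattice | reflexivity]. }
  destruct (rho alpha) as [r | |]; simpl in Hup, Hlo; [eauto | easy | easy].
Qed.

End Chain.

Theorem theorem3 :
  (forall Rr : Z, Z.odd Rr = true -> (3 <= Rr)%Z ->
     exists alpha : R, has_expansion Rr alpha) /\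
  (exists (C : R) (N : Z), forall Rr : Z,
     Z.odd Rr = true -> (3 <= Rr)%Z -> (N <= Rr)%Z ->
     forall alpha : R, has_expansion Rr alpha ->
       exists r : R, rho alpha = Finite r /\
         Rabs (r - / 4 * (1 - 3 / IZR Rr + 4 / (IZR Rr ^ 2))) <= C / (IZR Rr ^ 3)).
Proof.
  split; [intros Rr _; apply has_expansion_exists |].
  (* 2500 is 10000/4 from the upper threshold; the lower one needs only 600/4. *)
  exists 2500, 1000000%Z; intros Rr Hodd _ HR alpha Hexp.
  destruct (rho_bounds Rr alpha HR Hexp Hodd) as [r [Hr Hb]].
  exists r; split; [exact Hr |].
  pose proof (Rr_large Rr HR) as HRl.
  unfold deficit_threshold, excess_threshold in Hb; unfold Rdiv.
  rewrite <- !pow_inv.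
  assert (0 < (/ IZR Rr) ^ 3) by (apply pow_lt, Rinv_0_lt_compat; lra).
  apply Rabs_le; lra.
Qed.
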